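(* Let $q>3$ be a fixed integer, let $u\in\{0,1,\dots,q-1\}$ be fixed, and let $\Theta=\{1,2,\dots,q-1\}\setminus\{u\}$. Let $D(g)$ be the set of all numbers $x$ of the form $$x=\Delta^q_{\underbrace{u\ldots u}_{\alpha_1-1}\alpha_1\underbrace{u\ldots u}_{\alpha_2-1}\alpha_2\ldots\underbrace{u\ldots u}_{\alpha_n-1}\alpha_n\ldots}=\frac{u}{q-1}+\sum_{n=1}^{\infty}\frac{\alpha_n-u}{q^{\alpha_1+\alpha_2+\dots+\alpha_n}},\qquad \alpha_n\in\Theta \text{ for all } n,$$ and let $g$ be the function on $D(g)$ that maps such an $x$ to $$g(x)=\Delta^q_{\alpha_1\alpha_2\ldots\alpha_n\ldots}=\sum_{n=1}^{\infty}\frac{\alpha_n}{q^n}.$$ Then: 1. The domain $D(g)$ is an uncountable, perfect, nowhere dense set of zero Lebesgue measure, and is a self-similar fractal whose Hausdorff dimension $\alpha_0$ satisfies the equation $$\sum_{p\in\{1,2,\dots,q-1\},\ p\ne u}\left(\frac1q\right)^{p\alpha_0}=1.$$ 2. The range of $g$ is the self-similar fractal $E(g)=\{y: y=\Delta^q_{\alpha_1\alpha_2\ldots\alpha_n\ldots},\ \alpha_n\in\Theta\}$, whose Hausdorff dimension is $\log_q|\Theta|$, where $|\Theta|$ is the number of elements of $\Theta$. 3. The function $g$ is well defined on $D(g)$ and is a bijective mapping (of $D(g)$ onto $E(g)$). 4. On its domain, $g$ is: decreasing if $u\in\{0,1\}$ (for all $q>3$); increasing if $u\in\{q-2,q-1\}$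 (for all $q>3$); not monotonic if $u\in\{2,3,\dots,q-3\}$ and $q>4$. 5. The function $g$ is continuous at every point of its domain. 6. The function $g$ is non-differentiable on its domain. 7. For every $x\in D(g)$ with associated sequence $(\alpha_n)$, $$g\left(\sigma^{\alpha_1}(x)\right)=\sigma(g(x)),\qquad g\left(\sigma^{\alpha_1+\alpha_2+\dots+\alpha_n}(x)\right)=\sigma^n(g(x))\quad (n\in\mathbb N),$$ where $\sigma$ is the shift operator. 8. The function $g$ does not preserve the Hausdorff dimension.
   Context: Notation: $\Delta^q_{d_1d_2\ldots d_n\ldots}=\sum_{n\ge1} d_n q^{-n}$ with $d_n\in\{0,1,\dots,q-1\}$ is the $q$-ary representation of a number in $[0,1]$. In the definition of $D(g)$, the digit string consists of successive blocks, the $n$-th block being the digit $u$ repeated $\alpha_n-1$ times followed by the digit $\alpha_n$. The shift operator $\sigma$ deletes the first $q$-ary digit: $\sigma(\Delta^q_{d_1d_2d_3\ldots})=\Delta^q_{d_2d_3\ldots}$, and $\sigma^k$ is its $k$-fold iterate; it is applied to the digit representations displayed in the definition of $g$ (for $x$, the block representation; for $g(x)$, the representation $\Delta^q_{\alpha_1\alpha_2\ldots}$). A self-similar fractal is a self-similar set: a nonempty compact set that is the union of finitely many of its images under contracting similarities. Continuity, monotonicity and differentiability of $g$ are understood for $g$ as a function on the set $D(g)\subset[0,1]$. ''$g$ does not preserve the Hausdorff dimension'' means that there exists a set $S\subseteq D(g)$ such that the Hausdorff dimensions of $S$ and $g(S)$ are different. *)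

(* Defs.v *)
From HB Require Import structures.
From mathcomp Require Import all_boot all_order all_algebra.
From mathcomp Require Import all_classical all_reals all_analysis.

Set Implicit Arguments.
Unset Strict Implicit.
Unset Printing Implicit Defensive.

Import Order.TTheory GRing.Theory Num.Theory.
Import numFieldNormedType.Exports.

Local Open Scope classical_set_scope.
Local Open Scope ring_scope.

Section Hausdorff.
Context {R : realType}.
Implicit Types (A : set R) (s delta : R).

(* The diameter of the empty set is -oo; see [diam_pow]. *)
Definition diam A : \bar R :=
  ereal_sup [set (`|z.1 - z.2|)%:E | z in A `*` A].

(* |A|^s, where empty sets contribute 0 for every s >= 0, including s = 0. *)
Definition diam_pow s A : \bar R :=
  if A == set0 then 0%E else (diam A `^ s)%E.

Definition delta_cover delta A : set (nat -> set R) :=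
  [set U | A `<=` \bigcup_i U i /\ forall i, (diam (U i) <= delta%:E)%E].

Definition hausdorff_premeasure delta s A : \bar R :=
  ereal_inf [set (\sum_(0 <= i <oo) diam_pow s (U i))%E
            | U in delta_cover delta A].

Definition hausdorff_measure s A : \bar R :=
  ereal_sup [set hausdorff_premeasure delta s A
            | delta in [set delta : R | 0 < delta]].

Definition hausdorff_dim A : \bar R :=
  ereal_inf [set s%:E | s in [set s : R | 0 <= s /\ hausdorff_measure s A = 0%E]].

Definition contracting_similarity (f : R -> R) : Prop :=
  exists r : R, 0 < r < 1 /\ forall x y, `|f x - f y| = r * `|x - y|.

Definition self_similar A : Prop :=
  [/\ A !=set0, compact A &
      exists (n : nat) (f : 'I_n -> R -> R),
        (forall i, contracting_similarity (f i)) /\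
        A = \bigcup_(i in [set: 'I_n]) (f i @` A)].

Definition nowhere_dense A : Prop := interior (closure A) = set0.

Definition increasing_on A (f : R -> R) : Prop :=
  forall x y, A x -> A y -> x < y -> f x < f y.

Definition decreasing_on A (f : R -> R) : Prop :=
  forall x y, A x -> A y -> x < y -> f y < f x.

Definition monotonic_on A (f : R -> R) : Prop :=
  (forall x y, A x -> A y -> x <= y -> f x <= f y) \/
  (forall x y, A x -> A y -> x <= y -> f y <= f x).

(* Existence of a finite derivative at x along the points of A. *)
Definition derivable_on A (f : R -> R) (x : R) : Prop :=
  exists l : R, (f y - f x) / (y - x) @[y --> within A x^'] --> l.

End Hausdorff.

Section Digits.
Variable q : nat.

(* Sequences are indexed from 0, so [d n] is the digit of weight q^-(n+1) and
   [a n] stands for alpha_(n+1). *)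
Definition Delta {R : realType} (d : nat -> 'I_q) : R :=
  limn (series (fun n : nat => (d n)%:R / q%:R ^+ n.+1 : R)).

Definition sigma (d : nat -> 'I_q) : nat -> 'I_q := fun n => d n.+1.

Variable u : 'I_q.

Definition Theta : {set 'I_q} := [set p : 'I_q | (0 < p)%N && (p != u)].

Definition Theta_seq : set (nat -> 'I_q) := [set a | forall n, a n \in Theta].

Definition block (p : 'I_q) : seq 'I_q := rcons (nseq p.-1 u) p.

(* Blocks are nonempty, so the first k+1 of them already contain the digit of
   index k and the default value of [nth] is never reached. *)
Definition blocks (a : nat -> 'I_q) : nat -> 'I_q :=
  fun k => nth u (flatten (mkseq (block \o a) k.+1)) k.

Definition Dg {R : realType} : set R :=
  [set Delta (blocks a) | a in Theta_seq].

Definition Eg {R : realType} : set R := [set Delta a | a in Theta_seq].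

Definition g_graph {R : realType} (x y : R) : Prop :=
  exists a, [/\ Theta_seq a, x = Delta (blocks a) & y = Delta a].

(* Only the values on [Dg] are meaningful. *)
Definition g {R : realType} (x : R) : R := get (g_graph x).

Lemma size_blocks (a : nat -> 'I_q) (n : nat) : Theta_seq a ->
  size (flatten (mkseq (block \o a) n)) = (\sum_(i < n) a i)%N.
Proof.
move=> ha; elim: n => [|n IH]; first by rewrite big_ord0.
rewrite mkseqS flatten_rcons size_cat IH big_ord_recr /= size_rcons size_nseq.
by rewrite prednK //; have := ha n; rewrite inE => /andP[].
Qed.

Lemma leq_sum_Theta (a : nat -> 'I_q) (n : nat) : Theta_seq a ->
  (n <= \sum_(i < n) a i)%N.
Proof.
move=> ha; rewrite -[X in (X <= _)%N]card_ord -sum1_card; apply: leq_sum => i _.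
by have := ha i; rewrite inE => /andP[].
Qed.

Lemma blocksE (a : nat -> 'I_q) (n j : nat) : Theta_seq a -> (j < a n)%N ->
  blocks a ((\sum_(i < n) a i) + j)%N = if j == (a n).-1 then a n else u.
Proof.
move=> ha hj.
have an0 : (0 < a n)%N by exact: leq_ltn_trans hj.
have pre m p k : (m <= p)%N -> (k < size (flatten (mkseq (block \o a) m)))%N ->
    nth u (flatten (mkseq (block \o a) p)) k =
    nth u (flatten (mkseq (block \o a) m)) k.
  move=> /subnKC <- hk; elim: (p - m)%N => [|r IH]; first by rewrite addn0.
  rewrite addnS mkseqS flatten_rcons nth_cat IH ifT //.
  by apply: leq_trans hk _; rewrite !size_blocks// big_split_ord leq_addr.
rewrite /blocks; set k := (_ + j)%N.
have hk : (k < size (flatten (mkseq (block \o a) n.+1)))%N.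
  by rewrite size_blocks// big_ord_recr /= ltn_add2l.
have hk' : (k < size (flatten (mkseq (block \o a) k.+1)))%N.
  by rewrite size_blocks//; exact: leq_sum_Theta.
rewrite -(pre _ _ _ (leq_maxl k.+1 n.+1) hk') (pre _ _ _ (leq_maxr k.+1 n.+1) hk).
rewrite mkseqS flatten_rcons nth_cat size_blocks// ifF; last first.
  by rewrite ltnNge leq_addr.
rewrite addKn /= /block nth_rcons size_nseq nth_nseq.
have : (j <= (a n).-1)%N by rewrite -ltnS prednK.
by rewrite leq_eqVlt => /orP[/eqP->|h]; rewrite ?ltnn ?eqxx// h (ltn_eqF h).
Qed.

(* The series form of the elements of [Dg]. *)
Lemma Delta_blocks (R : realType) (a : nat -> 'I_q) :
  (1 < q)%N -> Theta_seq a ->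
  (fun N => u%:R / (q%:R - 1) +
     \sum_(n < N) ((a n)%:R - u%:R) / q%:R ^+ (\sum_(i < n.+1) a i)%N : R)
    @ \oo --> (Delta (blocks a) : R).
Proof.
move=> q1 ha.
have q0 : (0 : R) < q%:R by rewrite ltr0n ltnW.
have qn0 : (q%:R : R) != 0 by rewrite gt_eqF.
have qV1 : `|(q%:R : R)^-1| < 1.
  by rewrite ger0_norm ?invr_ge0 ?ltW// invf_lt1// ltr1n.
have cgeo (c : R) : series (fun n : nat => c / q%:R ^+ n.+1) @ \oo -->
    c / (q%:R - 1).
  have := @cvg_geometric_series R (c / q%:R) q%:R^-1 qV1.
  have -> : series (geometric (c / q%:R) q%:R^-1) =
            series (fun n : nat => c / q%:R ^+ n.+1).
    apply/funext => n; rewrite !seriesEnat; apply: eq_bigr => i _ /=.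
    by rewrite exprS invfM exprVn mulrA.
  suff -> : c / q%:R * (1 - q%:R^-1)^-1 = c / (q%:R - 1) by [].
  by rewrite -mulrA -invfM mulrBr mulr1 divff.
pose e (w : nat -> 'I_q) : R^nat := fun n => (w n)%:R / q%:R ^+ n.+1.
have cd : cvgn (series (e (blocks a))).
  apply: (@series_le_cvg _ _ (fun n : nat => q%:R / q%:R ^+ n.+1)).
  - by move=> n; rewrite divr_ge0// exprn_ge0// ltW.
  - by move=> n; rewrite divr_ge0// ?exprn_ge0// ltW.
  - move=> n; rewrite ler_wpM2r ?invr_ge0 ?exprn_ge0 ?ltW//.
    by rewrite ltr_nat.
  - by apply/cvg_ex; eexists; exact: cgeo.
have cS : (fun N => \sum_(i < N) a i)%N @ \oo --> \oo.
  move=> A [m _ hm]; exists m => // N /= mN; apply: hm => /=.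
  exact: leq_trans mN (leq_sum_Theta _ ha).
pose v : R^nat := fun n => u%:R / q%:R ^+ n.+1.
have cdS : (fun N => series (e (blocks a)) (\sum_(i < N) a i)%N) @ \oo -->
    (Delta (blocks a) : R) by apply: (cvg_comp _ _ cS); exact: cd.
have cvS : (fun N => series v (\sum_(i < N) a i)%N) @ \oo -->
    (u%:R / (q%:R - 1) : R).
  by apply: (cvg_comp _ _ cS); exact: cgeo.
have key N : \sum_(n < N) ((a n)%:R - u%:R) / q%:R ^+ (\sum_(i < n.+1) a i)%N =
    series (e (blocks a)) (\sum_(i < N) a i)%N -
    series v (\sum_(i < N) a i)%N :> R.
  rewrite !seriesEord -sumrB /=; elim: N => [|N IH]; first by rewrite !big_ord0.
  rewrite big_ord_recr /= IH; set S := (\sum_(i < N) a i)%N.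
  have an0 : (0 < a N)%N by have := ha N; rewrite inE => /andP[].
  rewrite -(big_mkord xpredT (fun i => e (blocks a) i - v i)).
  rewrite -(big_mkord xpredT (fun i => e (blocks a) i - v i)) big_ord_recr /=.
  rewrite -/S (big_cat_nat (n := S) _ (leq_addr _ _))//=; congr (_ + _).
  rewrite -[X in _ = \sum_(X <= _ < _) _]add0n big_addn addKn big_mkord.
  have hl : ((a N).-1 < a N)%N by rewrite prednK.
  rewrite (bigD1 (Ordinal hl)) //= big1 ?addr0.
    rewrite /e /v [(_ + S)%N]addnC blocksE// eqxx -mulrBl.
    by rewrite -addnS prednK.
  move=> i ni; rewrite /e /v [(_ + S)%N]addnC blocksE// ifF ?subrr//.
  by apply/negP => /eqP hi; move/eqP: ni; apply; exact/val_inj.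
have -> : (fun N => u%:R / (q%:R - 1) +
     \sum_(n < N) ((a n)%:R - u%:R) / q%:R ^+ (\sum_(i < n.+1) a i)%N : R) =
   (fun N => u%:R / (q%:R - 1) + (series (e (blocks a)) (\sum_(i < N) a i)%N -
    series v (\sum_(i < N) a i)%N)) by apply/funext => N; rewrite key.
have -> : (Delta (blocks a) : R) =
  u%:R / (q%:R - 1) + (Delta (blocks a) - u%:R / (q%:R - 1)).
  by rewrite addrC subrK.
by apply: cvgD; [exact: cvg_cst | apply: cvgB].
Qed.

End Digits.

(* Main.v *)
(** Both [D(g)] and [E(g)] are images of the sequences over [Theta] under coding
    maps [X] with [X a = c (a 0) + r (a 0) * X (shift a)], values in [[0, 1]], and a
    uniform gap between sequences with different first letters; the ratios [r p]
    are [q^-p] for [D(g)] and [q^-1] for [E(g)]. Sequences that first differ at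
    index [n] are thus coded at a distance comparable to the product of their first
    [n] ratios, which makes the coding a homeomorphism onto a Cantor set. Its
    dimension is the root [s] of [sum_p r_p^s = 1]: covering by the cylinders of
    length [n] bounds it from above, and for the lower bound each set of a cover is
    enclosed in a cylinder of comparable size, while cylinders whose weights [r^s]
    sum to less than 1 cannot cover.

    [g] recodes one set into the other and multiplies differences at depth [n] by
    the quotient [q^(a_1 + ... + a_n - n)] of the two products of ratios. This is
    unbounded unless [a] is eventually 1, in which case differentiability would force
    [g] to be affine on the whole of [D(g)]. Finally [sum_p q^(-ps)] is strictly
    smaller than [|Theta| q^-s] for [s > 0], so the two dimensions differ. *)

Require Import Defs.
From HB Require Import structures.
From mathcomp Require Import all_boot all_order all_algebra.
From mathcomp Require Import all_classical all_reals all_analysis.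
From mathcomp Require Import zify ring lra.

Set Implicit Arguments.
Unset Strict Implicit.
Unset Printing Implicit Defensive.

Import Order.TTheory GRing.Theory Num.Theory.
Import numFieldNormedType.Exports.

Local Open Scope classical_set_scope.
Local Open Scope ring_scope.

(** * Hausdorff measure and dimension on the line *)

Section HausdorffFacts.
Context {R : realType}.
Implicit Types (U B : set R) (s t d e : R).

Lemma diam_le U d : (forall x y, U x -> U y -> `|x - y| <= d) ->
  (diam U <= d%:E)%E.
Proof.
move=> h; apply: ge_ereal_sup => _ [[x y] [/= Ux Uy] <-].
by rewrite lee_fin h.
Qed.

Lemma le_diam U x y : U x -> U y -> ((`|x - y|)%:E <= diam U)%E.
Proof. by move=> Ux Uy; apply: ereal_sup_ubound; exists (x, y). Qed.

Lemma diam_ge0 U : U !=set0 -> (0 <= diam U)%E.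
Proof.
by move=> [x Ux]; apply: le_trans (le_diam Ux Ux); rewrite subrr normr0.
Qed.

Lemma diam_pow0 t : diam_pow t (@set0 R) = 0%E.
Proof. by rewrite /diam_pow eqxx. Qed.

Lemma diam_pow_ge0 t U : (0 <= diam_pow t U)%E.
Proof. by rewrite /diam_pow; case: ifP => // _; exact: poweR_ge0. Qed.

Lemma diam_pow_le t U d : 0 <= t -> 0 <= d ->
  (forall x y, U x -> U y -> `|x - y| <= d) ->
  (diam_pow t U <= (d `^ t)%:E)%E.
Proof.
move=> t0 d0 h; rewrite /diam_pow; case: ifPn => [_|U0].
  by rewrite lee_fin powR_ge0.
rewrite -poweR_EFin; apply: gt0_ler_poweR => //.
- by rewrite in_itv/= leey andbT diam_ge0//; exact/set0P.
- by rewrite in_itv/= leey andbT lee_fin.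
- exact: diam_le.
Qed.

Lemma le_diam_pow t U x y : 0 <= t -> U x -> U y ->
  ((`|x - y| `^ t)%:E <= diam_pow t U)%E.
Proof.
move=> t0 Ux Uy; rewrite /diam_pow ifF; last first.
  by apply/negbTE/set0P; exists x.
rewrite -poweR_EFin; apply: gt0_ler_poweR => //.
- by rewrite in_itv/= leey andbT lee_fin.
- by rewrite in_itv/= leey andbT diam_ge0//; exists x.
- exact: le_diam.
Qed.

(** One parameter for mesh and sum suffices: covers with error [Num.min d e] meet any mesh [d] and
    any error [e] at once. *)
Lemma hausdorff_measure_eq0 t B :
  (forall e, 0 < e -> exists2 U, delta_cover e B U &
     (\sum_(0 <= i <oo) diam_pow t (U i) <= e%:E)%E) ->
  hausdorff_measure t B = 0%E.
Proof.
move=> h; apply/eqP; rewrite eq_le; apply/andP; split.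
  apply: ge_ereal_sup => _ [d d0 <-]; apply/lee_addgt0Pr => e e0; rewrite add0e.
  have m0 : 0 < Num.min d e by rewrite lt_min d0.
  have [U [BU dU] hU] := h _ m0.
  apply: ge_ereal_inf; exists (\sum_(0 <= i <oo) diam_pow t (U i))%E.
    exists U => //; split => // i; apply: le_trans (dU i) _.
    by rewrite lee_fin ge_min lexx.
  by apply: le_trans hU _; rewrite lee_fin ge_min lexx orbT.
apply: le_ereal_sup_tmp; exists (hausdorff_premeasure 1 t B).
  by exists 1 => //=.
apply: le_ereal_inf_tmp => _ [U _ <-].
by apply: nneseries_ge0 => i _ _; exact: diam_pow_ge0.
Qed.

Lemma hausdorff_measure_ge t B e :
  (forall U : nat -> set R, B `<=` \bigcup_i U i ->
     (e%:E <= \sum_(0 <= i <oo) diam_pow t (U i))%E) ->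
  (e%:E <= hausdorff_measure t B)%E.
Proof.
move=> h; apply: le_ereal_sup_tmp; exists (hausdorff_premeasure 1 t B).
  by exists 1 => //=.
by apply: le_ereal_inf_tmp => _ [U [BU _] <-]; exact: h.
Qed.

Lemma hausdorff_dim_eq s B : 0 <= s ->
  (forall t, s < t -> hausdorff_measure t B = 0%E) ->
  (forall t, 0 <= t < s -> hausdorff_measure t B <> 0%E) ->
  hausdorff_dim B = s%:E.
Proof.
move=> s0 hgt hlt; apply/eqP; rewrite eq_le; apply/andP; split.
  apply/lee_addgt0Pr => e e0; apply: ereal_inf_lbound; exists (s + e) => //.
  by split; [rewrite addr_ge0// ltW|apply: hgt; rewrite ltrDl].
apply: le_ereal_inf_tmp => _ [t [t0 ht] <-]; rewrite lee_fin leNgt.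
by apply/negP => ts; apply: (hlt t) => //; rewrite t0.
Qed.

(** A nonempty set of diameter d lies in the interval of radius d around any of its points, so a
    cheap cover for exponent 1 gives intervals of at most twice the total length. *)
Lemma hausdorff_measure1_null B : measurable B ->
  hausdorff_measure 1 B = 0%E -> lebesgue_measure B = 0%E.
Proof.
move=> mB H0; apply/eqP; rewrite eq_le measure_ge0 andbT.
apply/lee_addgt0Pr => e e0; rewrite add0e.
have /ereal_inf_lt[_ [U [BU dU] <-] hU] :
    (hausdorff_premeasure 1 1 B < (e / 2)%:E)%E.
  apply: (@le_lt_trans _ _ 0%E); last by rewrite lte_fin divr_gt0.
  by rewrite -H0; apply: ereal_sup_ubound; exists 1 => //=.
pose x i := xget 0 (U i).
pose W i : set R := if U i == set0 then set0
  else `[x i - fine (diam (U i)), x i + fine (diam (U i))]%classic.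
have fd i : U i != set0 -> diam (U i) \is a fin_num.
  move=> /set0P U0; rewrite ge0_fin_numE ?diam_ge0//.
  by apply: le_lt_trans (dU i) _; rewrite ltry.
have UW i : U i `<=` W i.
  move=> y Uy; have U0 : U i != set0 by apply/set0P; exists y.
  rewrite /W (negbTE U0) /= in_itv/=.
  have Ux : U i (x i) by apply: xgetPex; exists y.
  have := le_diam Uy Ux; rewrite -(fineK (fd i U0)) lee_fin ler_norml.
  by move=> /andP[h1 h2]; apply/andP; split; lra.
apply: (@le_trans _ _ (\sum_(0 <= i <oo) lebesgue_measure (W i))%E).
  apply: measure_sigma_subadditive => //; last first.
    by move=> y /BU[i _ Uy]; exists i => //; exact: UW.
  by move=> i; rewrite /W; case: ifP.
apply: (@le_trans _ _ (\sum_(0 <= i <oo) (2%:E * diam_pow 1 (U i)))%E).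
  apply: lee_nneseries => // i _; rewrite /W /diam_pow; case: ifPn => [_|U0].
    by rewrite measure0 mule0.
  have d0 : (0 <= diam (U i))%E by apply: diam_ge0; exact/set0P.
  rewrite poweRe1// lebesgue_measure_itv/=; case: ifP => _; last first.
    by rewrite mule_ge0.
  rewrite -{3}(fineK (fd i U0)) -EFinD -EFinM lee_fin; lra.
rewrite nneseriesZl; last by move=> i _; exact: diam_pow_ge0.
rewrite (_ : e = 2 * (e / 2)); last by field.
by rewrite EFinM lee_pmul2l// ltW.
Qed.

(** Covers are sequences, so a finite one is padded with empty sets, which cost nothing in
    [diam_pow]. *)
Definition finite_family (J : finType) (V : J -> set R) : nat -> set R :=
  fun i => if @insub nat (fun i => i < #|J|)%N 'I_#|J| i is Some o
           then V (enum_val o) else set0.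

Lemma finite_family_enum_rank (J : finType) (V : J -> set R) j :
  finite_family V (enum_rank j) = V j.
Proof. by rewrite /finite_family valK enum_rankK. Qed.

Lemma finite_family_ind (J : finType) (V : J -> set R) (P : set R -> Prop) :
  P set0 -> (forall j, P (V j)) -> forall i, P (finite_family V i).
Proof. by move=> P0 PV i; rewrite /finite_family; case: insub. Qed.

Lemma sum_finite_family (J : finType) (V : J -> set R) (F : set R -> \bar R) :
  F set0 = 0%E -> (forall B, 0 <= F B)%E ->
  (\sum_(0 <= i <oo) F (finite_family V i) = \sum_(j : J) F (V j))%E.
Proof.
move=> F0 Fge0; rewrite (nneseries_split 0 #|J|)//.
rewrite add0n [X in (_ + X)%E]eseries0 ?adde0; last first.
  by move=> i Ji _; rewrite /finite_family insubN// -leqNgt.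
rewrite big_mkord (reindex enum_rank) /=; last first.
  by apply: onW_bij; exact: enum_rank_bij.
by apply: eq_bigr => j _; rewrite finite_family_enum_rank.
Qed.

End HausdorffFacts.

(** * Sets coded by sequences over a finite alphabet *)

Section Words.
Context {I : finType} (A : {set I}).
Implicit Types (a b t : nat -> I) (w : seq I).

Definition admissible : set (nat -> I) := [set a | forall n, a n \in A].

Definition shiftn n a : nat -> I := fun k => a (n + k)%N.

Definition splice a n t : nat -> I :=
  fun k => if (k < n)%N then a k else t (k - n)%N.

Definition cylinder w : set (nat -> I) :=
  [set a | admissible a /\ mkseq a (size w) = w].

Lemma shiftn_admissible n a : admissible a -> admissible (shiftn n a).
Proof. by move=> ha k; exact: ha. Qed.

Lemma splice_admissible a n t :
  admissible a -> admissible t -> admissible (splice a n t).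
Proof. by move=> ha ht k; rewrite /splice; case: ifP. Qed.

Lemma mkseq_eqP a b n :
  mkseq a n = mkseq b n <-> (forall k, (k < n)%N -> a k = b k).
Proof.
split=> [h k kn|h].
  by have := congr1 (fun s => nth (a 0%N) s k) h; rewrite !nth_mkseq.
by apply: (@eq_from_nth _ (a 0%N)) => [|i]; rewrite !size_mkseq // => hi;
  rewrite !nth_mkseq // h.
Qed.

Lemma mkseq_splice a n t : mkseq (splice a n t) n = mkseq a n.
Proof. by apply/mkseq_eqP => k kn; rewrite /splice kn. Qed.

Lemma shiftn_splice a n t : shiftn n (splice a n t) = t.
Proof.
by apply/funext => k; rewrite /shiftn /splice ltnNge leq_addr /= addKn.
Qed.

Lemma shiftnS n a : shiftn 1 (shiftn n a) = shiftn n.+1 a.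
Proof. by apply/funext => k; rewrite /shiftn addnA addn1. Qed.

Lemma shiftn0 a : shiftn 0 a = a.
Proof. by apply/funext => k; rewrite /shiftn add0n. Qed.

Lemma cylinder_mkseq a n : admissible a -> cylinder (mkseq a n) a.
Proof. by move=> ha; split => //; rewrite size_mkseq. Qed.

Lemma first_difference a b : a <> b ->
  exists n, mkseq a n = mkseq b n /\ a n != b n.
Proof.
move=> ab; have ex : exists n, a n != b n.
  apply/not_existsP => h; apply: ab; apply/funext => n.
  by apply/eqP; apply/negPn/negP; exact: h.
exists (ex_minn ex); case: ex_minnP => n abn hn; split => //.
apply/mkseq_eqP => k kn; apply/eqP/negPn/negP => /hn.
by rewrite leqNgt kn.
Qed.

(** Dependent choice: letters are appended one at a time. Compactness and the covering bound both
    build their sequence this way. *)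
Lemma greedy_admissible (Q : seq I -> Prop) : Q [::] ->
  (forall w, Q w -> exists2 p, p \in A & Q (rcons w p)) ->
  exists2 a, admissible a & forall n, Q (mkseq a n).
Proof.
move=> Q0 QS; have [p0 p0A _] := QS _ Q0.
pose h w : I := if pselect (Q w) is left e then sval (cid2 (QS w e)) else p0.
have hA w : h w \in A.
  by rewrite /h; case: pselect => // e; case: cid2.
have hQ w : Q w -> Q (rcons w (h w)).
  by move=> e; rewrite /h; case: pselect => // e'; case: cid2.
pose W n := iter n (fun w => rcons w (h w)) [::].
exists (fun n => h (W n)) => [n|n]; first exact: hA.
suff -> : mkseq (fun n => h (W n)) n = W n by elim: n => //= n IH; exact: hQ.
by elim: n => // n IH; rewrite mkseqS IH.
Qed.

End Words.

(** [X] codes the attractor of the iterated function system of the maps [x => c p + r p * x], [p] in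
    [A]; [coding_gap] is the strong separation of its first-level pieces. *)
Record coding {R : realType} {I : finType} (A : {set I}) (r c : I -> R) (k : R)
    (X : (nat -> I) -> R) : Prop := Coding {
  coding_ratio : forall p, p \in A -> 0 < r p < 1 ;
  coding_rec : forall a, admissible A a ->
    X a = c (a 0%N) + r (a 0%N) * X (shiftn 1 a) ;
  coding_unit : forall a, admissible A a -> 0 <= X a <= 1 ;
  coding_gap_gt0 : 0 < k ;
  coding_gap : forall a b, admissible A a -> admissible A b ->
    a 0%N != b 0%N -> k <= `|X a - X b| }.

(** * Topology and self-similarity of coded sets *)

Section Coding.
Context {R : realType} {I : finType} (A : {set I}) (r c : I -> R) (k : R).
Context (X : (nat -> I) -> R) (cX : coding A r c k X).
Implicit Types (a b t : nat -> I) (w : seq I).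

Local Notation adm := (admissible A).
Local Notation K := (X @` adm).

Definition ratio w : R := \prod_(p <- w) r p.

Lemma ratio_gt0 w : {subset w <= A} -> 0 < ratio w.
Proof.
move=> hw; rewrite /ratio big_seq; apply: prodr_gt0 => p /hw.
by move=> /(coding_ratio cX)/andP[].
Qed.

Lemma mkseq_subset a n : adm a -> {subset mkseq a n <= A}.
Proof. by move=> ha p /mapP[i _ ->]. Qed.

Lemma ratio_mkseq_gt0 a n : adm a -> 0 < ratio (mkseq a n).
Proof. by move=> ha; apply: ratio_gt0; exact: mkseq_subset. Qed.

Lemma ratio_mkseqS a n : ratio (mkseq a n.+1) = ratio (mkseq a n) * r (a n).
Proof. by rewrite /ratio mkseqS big_rcons. Qed.

(** The translations [c] cancel on a common prefix, leaving only the product of its ratios. *)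
Lemma coding_diff a b n : adm a -> adm b -> mkseq a n = mkseq b n ->
  X a - X b = ratio (mkseq a n) * (X (shiftn n a) - X (shiftn n b)).
Proof.
move=> ha hb; elim: n => [|n IH].
  by rewrite /ratio big_nil mul1r !shiftn0.
rewrite [in X in X -> _]mkseqS [in X in X -> _]mkseqS => /rcons_inj[/IH -> e].
rewrite (coding_rec cX (shiftn_admissible n ha)).
rewrite (coding_rec cX (shiftn_admissible n hb)) !shiftnS /shiftn addn0 -e.
by rewrite ratio_mkseqS; ring.
Qed.

Lemma coding_dist1 a b : adm a -> adm b -> `|X a - X b| <= 1.
Proof.
move=> /(coding_unit cX)/andP[a0 a1] /(coding_unit cX)/andP[b0 b1].
by rewrite ler_norml; apply/andP; split; [rewrite lerBrDr addrC|];
  lra.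
Qed.

Lemma coding_dist_le a b n : adm a -> adm b -> mkseq a n = mkseq b n ->
  `|X a - X b| <= ratio (mkseq a n).
Proof.
move=> ha hb e; rewrite (coding_diff ha hb e) normrM gtr0_norm.
  by rewrite ler_piMr ?(ltW (ratio_mkseq_gt0 _ ha)) ?coding_dist1//;
    exact: shiftn_admissible.
exact: ratio_mkseq_gt0.
Qed.

Lemma coding_dist_ge a b n : adm a -> adm b -> mkseq a n = mkseq b n ->
  a n != b n -> k * ratio (mkseq a n) <= `|X a - X b|.
Proof.
move=> ha hb e d; rewrite (coding_diff ha hb e) normrM gtr0_norm ?ratio_mkseq_gt0//.
rewrite mulrC ler_pM2l ?ratio_mkseq_gt0//.
apply: (coding_gap cX); [exact: shiftn_admissible..|].
by rewrite /shiftn addn0.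
Qed.

Lemma coding_inj a b : adm a -> adm b -> X a = X b -> a = b.
Proof.
move=> ha hb e; apply: contrapT => ab; have [n [en dn]] := first_difference ab.
have := coding_dist_ge ha hb en dn; rewrite e subrr normr0 leNgt.
by rewrite mulr_gt0 ?(coding_gap_gt0 cX) ?ratio_mkseq_gt0.
Qed.

Lemma ratio_max : exists2 l : R, 0 <= l < 1 & forall p, p \in A -> r p <= l.
Proof.
exists (\big[Num.max/0]_(p in A) r p); last first.
  by move=> p pA; exact: le_bigmax_cond.
rewrite bigmax_ge_id/=; apply: bigmax_lt => // p /(coding_ratio cX).
by case/andP.
Qed.

(** Uniform in [a]: over a finite alphabet the ratios are bounded by some [l] below 1, and a product
    of [n] of them is at most [l ^+ n]. *)
Lemma ratio_small (e : R) : 0 < e ->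
  exists N, forall n a, (N <= n)%N -> adm a -> ratio (mkseq a n) < e.
Proof.
move=> e0; have [l /andP[l0 l1] hl] := ratio_max.
have : (l ^+ n @[n --> \oo] --> 0) by apply: cvg_expr; rewrite ger0_norm.
move=> /cvgrPdist_lt /(_ _ e0)[N _ hN]; exists N => n a Nn ha.
have := hN n Nn; rewrite sub0r normrN ger0_norm ?exprn_ge0//.
apply: le_lt_trans; elim: n {Nn} => [|n IH].
  by rewrite /ratio big_nil expr0.
rewrite ratio_mkseqS exprSr ler_pM ?hl// ltW// ?ratio_mkseq_gt0//.
by have /andP[] := coding_ratio cX (ha n).
Qed.

(** With finitely many letters, a limit point [x] stays in the closure of some cylinder at each next
    level; these nested cylinders shrink to one coded point, which must be [x]. *)
Lemma coding_compact : compact K.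
Proof.
suff cl : closed K.
  apply: (subclosed_compact cl (@segment_compact _ 0 1)).
  by move=> _ [a ha <-] /=; rewrite in_itv/= (coding_unit cX).
move=> x hx.
have [||a ha h] := @greedy_admissible I A (fun w => closure (X @` cylinder A w) x).
- suff -> : cylinder A [::] = adm by [].
  by apply/seteqP; split => [a []//|a ha]; exact: (@cylinder_mkseq _ A a 0).
- move=> w hw; apply: contrapT => h.
  (* If every extension fails, finitely many neighbourhoods of [x], one per letter, intersect in one
     that misses the whole cylinder of [w]. *)
  have : \forall y \near x, forall p, ~ (X @` cylinder A (rcons w p)) y.
    apply: (@filter_forall _ _ (fun p y => ~ (X @` cylinder A (rcons w p)) y) (nbhs x) _) => p.
    have [pA|pA] := boolP (p \in A).
      have /existsNP[B /not_implyP[nB B0]] :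
        ~ closure (X @` cylinder A (rcons w p)) x by move=> hp; apply: h; exists p.
      by apply: filterS nB => y By Cy; apply: B0; exists y.
    near=> y => -[b [hb]]; rewrite size_rcons mkseqS => /rcons_inj[_ e].
    by move: pA; rewrite -e hb.
  move=> /hw[_ [[a [ha e] <-]]] /(_ (a (size w))); apply.
  by exists a => //; split => //; rewrite size_rcons mkseqS e.
exists a => //; apply/eqP/negPn/negP => nx.
have d0 : 0 < `|x - X a| / 2 by rewrite divr_gt0// normr_gt0 subr_eq0 eq_sym.
have [n hn] := ratio_small d0.
have [_ [[b [hb +] <-]]] := h n _ (nbhsx_ballx x _ d0).
rewrite size_mkseq /ball/= => e xb.
have := hn n a (leqnn _) ha; have := coding_dist_le hb ha e; rewrite e.
have := ler_distD (X b) x (X a); lra.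
Unshelve. all: by end_near.
Qed.

Hypothesis A2 : (1 < #|A|)%N.

Lemma other_digit p : exists2 p', p' \in A & p' != p.
Proof.
have /card_gt1P[x [y [xA yA xy]]] := A2.
by have [xp|xp] := eqVneq x p; [exists y; rewrite // -xp eq_sym|exists x].
Qed.

Lemma admissible_nonempty : exists a, adm a.
Proof.
by have /card_gt0P[p pA] := ltnW A2; exists (fun=> p) => n.
Qed.

Lemma coding_nonempty : K !=set0.
Proof. by have [a ha] := admissible_nonempty; exists (X a), a. Qed.

Lemma coding_perfect : perfect_set K.
Proof.
have cl : closed K by apply: compact_closed coding_compact; exact: Rhausdorff.
split => //; apply/seteqP; split=> [x hx|_ [a ha <-] U].
  by apply: cl => U /hx[y [_ Ky Uy]]; exists y.
move=> /nbhs_ballP[e /= e0 eU]; have [n hn] := ratio_small e0.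
have [p pA pa] := other_digit (a n).
have hb : adm (splice a n (fun=> p)) by apply: splice_admissible.
exists (X (splice a n (fun=> p))); split; [|by exists (splice a n (fun=> p))|].
- apply/eqP => /(coding_inj hb ha) /(congr1 (fun f => f n)) /eqP.
  by rewrite /splice ltnn (negbTE pa).
- apply: eU; rewrite /ball/=; apply: le_lt_trans (hn n a (leqnn _) ha).
  by apply: coding_dist_le => //; rewrite mkseq_splice.
Qed.

Lemma coding_closed : closed K.
Proof. by have [] := coding_perfect. Qed.

(** Cantor's diagonal argument: [d] differs at place [n] from the sequence [s n] whose code has
    number [n], if there is one. *)
Lemma coding_uncountable : ~ countable K.
Proof.
move=> /countable_injP[f finj].
have [h hA hn] : exists2 h : I -> I, (forall p, h p \in A) & forall p, h p != p.
  exists (fun p => sval (cid2 (other_digit p))) => p; by case: cid2.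
pose s n : nat -> I := xget (fun=> h (sval (cid admissible_nonempty) 0%N))
  [set a | adm a /\ f (X a) = n].
pose d n := h (s n n).
have hd : adm d by move=> n; exact: hA.
have [sd fd] : adm (s (f (X d))) /\ f (X (s (f (X d)))) = f (X d).
  by apply: (@xgetPex _ _ [set a | adm a /\ f (X a) = f (X d)]); exists d.
have /(coding_inj sd hd) e : X (s (f (X d))) = X d.
  by apply: finj => //; rewrite inE; [exists (s (f (X d)))|exists d].
by have := hn (s (f (X d)) (f (X d))); rewrite {2}e eqxx.
Qed.

Lemma coding_self_similar : self_similar K.
Proof.
split; [exact: coding_nonempty|exact: coding_compact|].
exists #|A|, (fun i x => c (enum_val i) + r (enum_val i) * x); split.
  move=> i; have rp := coding_ratio cX (enum_valP i).
  exists (r (enum_val i)); split => // x y.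
  rewrite (_ : _ - _ = r (enum_val i) * (x - y)); last by ring.
  by rewrite normrM gtr0_norm//; case/andP: rp.
apply/seteqP; split=> [_ [a ha <-]|_ [i _ [_ [a ha <-] <-]]].
  exists (enum_rank_in (ha 0%N) (a 0%N)) => //; rewrite enum_rankK_in ?ha//.
  exists (X (shiftn 1 a)); last by rewrite -(coding_rec cX ha).
  by exists (shiftn 1 a) => //; exact: shiftn_admissible.
pose b : nat -> I := fun n => if n is m.+1 then a m else enum_val i.
have hb : adm b by case=> [|n]; [exact: enum_valP|exact: ha].
by exists b; rewrite // (coding_rec cX hb).
Qed.

End Coding.

(** * Dimension of coded sets *)

Section Covering.
Context {R : realType} {I : finType} (A : {set I}) (m : I -> R).
Hypothesis m_ge0 : forall p, 0 <= m p.
Hypothesis m_sum1 : \sum_(p in A) m p = 1.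
Implicit Types (a : nat -> I) (w v : seq I) (o : option (seq I)).

(** For words over [A], the Bernoulli measure of the cylinder of [v] with weights [m]. *)
Definition mass v : R := \prod_(p <- v) m p.

(* [Some v] stands for the cylinder of [v], [None] for the empty set, and
   [residual o p] for the trace of [o] on the sequences starting with [p], with
   that first letter removed. *)
Definition residual o (p : I) : option (seq I) :=
  match o with
  | Some (x :: v) => if x == p then Some v else None
  | _ => o
  end.

Definition residual_mass o : R := if o is Some v then mass v else 0.

Lemma residual_mass_ge0 o : 0 <= residual_mass o.
Proof. by case: o => //= v; apply: prodr_ge0. Qed.

(** The whole space splits with weights of sum 1, a cylinder keeps its mass through its first
    letter, and a first letter outside [A] contributes nothing on the left. *)
Lemma sum_residual_mass o :
  \sum_(p in A) m p * residual_mass (residual o p) <= residual_mass o.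
Proof.
case: o => [[|x v]|] /=.
- by rewrite -mulr_suml m_sum1 mul1r.
- rewrite [leRHS]big_cons -/(mass v); have [xA|xA] := boolP (x \in A).
    rewrite (bigD1 x)//= eqxx big1 ?addr0// => p /andP[_ px].
    by rewrite eq_sym (negbTE px) mulr0.
  rewrite big1 ?mulr_ge0// ?(residual_mass_ge0 (Some v))// => p pA.
  by case: eqP => [xp|_]; [rewrite xp pA in xA|rewrite mulr0].
- by rewrite big1// => p _; rewrite mulr0.
Qed.

Lemma foldl_residual v : foldl residual (Some v) v = Some [::].
Proof. by elim: v => //= x v IH; rewrite eqxx. Qed.

(* If the total mass were below 1, letters could be chosen greedily so that the
   masses of the residuals keep a sum below 1; the resulting sequence would
   avoid every cylinder. *)
Lemma cylinder_cover_mass (v : nat -> seq I) :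
  (forall a, admissible A a -> exists i, cylinder A (v i) a) ->
  (1 <= \sum_(0 <= i <oo) (mass (v i))%:E)%E.
Proof.
move=> cov; rewrite leNgt; apply/negP => lt1.
pose S w := (\sum_(0 <= i <oo)
  (residual_mass (foldl residual (Some (v i)) w))%:E)%E.
have ge0 w i : (0 <= (residual_mass (foldl residual (Some (v i)) w))%:E)%E.
  by rewrite lee_fin residual_mass_ge0.
have [//|w Sw|a ha hS] := @greedy_admissible I A (fun w => (S w < 1)%E).
  apply: contrapT => h.
  have Sp p : p \in A -> (1 <= S (rcons w p))%E.
    by move=> pA; rewrite leNgt; apply/negP => Sp; apply: h; exists p.
  suff : (1 <= S w)%E by rewrite leNgt Sw.
  (* If the sums for all extensions are at least 1, so is their average with weights [m], which is
     at most [S w]. *)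
  apply: (@le_trans _ _ (\sum_(p in A) (m p)%:E * S (rcons w p))%E).
    rewrite -[leLHS]/(1%:E) -m_sum1 -sumEFin; apply: lee_sum => p pA.
    by rewrite -[leLHS]mule1 lee_wpmul2l ?lee_fin// Sp.
  rewrite (eq_bigr (fun p => \sum_(0 <= i <oo) ((m p)%:E *
     (residual_mass (foldl residual (Some (v i)) (rcons w p)))%:E))%E); last first.
    by move=> p pA; rewrite nneseriesZl.
  rewrite -nneseries_sum; last by move=> p i _; rewrite mule_ge0// lee_fin.
  apply: lee_nneseries => i _.
    by move=> _; apply: sume_ge0 => p _; rewrite mule_ge0// lee_fin.
  apply: le_trans (_ : ((\sum_(p in A) m p * residual_mass (residual
    (foldl residual (Some (v i)) w) p))%:E <= _)%E); last first.
    by rewrite lee_fin sum_residual_mass.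
  rewrite -sumEFin le_eqVlt; apply/orP; left; apply/eqP.
  by apply: eq_bigr => p _; rewrite foldl_rcons EFinM.
(* Once [v i] has been read, its own residual is the empty word, of mass 1, so the sum cannot be
   below 1. *)
have [i [_ e]] := cov a ha; have := hS (size (v i)); rewrite e ltNge => /negP; apply.
apply: le_trans (nneseries_lim_ge i.+1 _); last by [].
rewrite big_nat_recr//= foldl_residual /= /mass big_nil leeDr//.
exact: sume_ge0.
Qed.

End Covering.

(** * Hausdorff and Lebesgue measure of coded sets *)

Section CodingHausdorff.
Context {R : realType} {I : finType} (A : {set I}) (r c : I -> R) (k : R).
Context (X : (nat -> I) -> R) (cX : coding A r c k X).
Hypothesis A2 : (1 < #|A|)%N.
Implicit Types (a b : nat -> I) (w : seq I) (s t e : R).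

Local Notation adm := (admissible A).
Local Notation K := (X @` adm).

(** The Moran sum; the exponent at which it equals 1 is the similarity dimension. *)
Definition pressure t : R := \sum_(p in A) r p `^ t.

Lemma powR_prod (J : Type) (l : seq J) (P : pred J) (F : J -> R) t :
  (forall j, P j -> 0 <= F j) ->
  (\prod_(j <- l | P j) F j) `^ t = \prod_(j <- l | P j) F j `^ t.
Proof.
move=> F0; elim: l => [|j l IH]; first by rewrite !big_nil powR1.
rewrite !big_cons; case: ifP => // Pj.
by rewrite powRM ?F0 ?IH//; apply: prodr_ge0.
Qed.

Lemma pressure_lt s t : s < t -> pressure t < pressure s.
Proof.
move=> st; have /card_gt0P[p0 p0A] := ltnW A2.
have lt p : p \in A -> r p `^ t < r p `^ s.
  move=> /(coding_ratio cX)/andP[p0' p1]; rewrite /powR gt_eqF// ltr_expR.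
  by rewrite ltr_nM2r// ln_lt0// p0' p1.
rewrite /pressure (bigD1 p0)//= [ltRHS](bigD1 p0)//= ltr_leD ?lt//.
by apply: ler_sum => p /andP[pA _]; rewrite ltW ?lt.
Qed.

Lemma pressure_ge0 t : 0 <= pressure t.
Proof. by apply: sumr_ge0 => p _; exact: powR_ge0. Qed.

(** Words of length [n] are finite functions here, so that a power of the pressure expands over them
    by distributivity; a word that leaves [A] yields the empty set. *)
Definition level_set n (f : {ffun 'I_n -> I}) : set R :=
  X @` [set a | adm a /\ forall i : 'I_n, a i = f i].

Lemma ratio_mkseqE a n : ratio r (mkseq a n) = \prod_(i < n) r (a i).
Proof. by rewrite /ratio big_map -(big_mkord xpredT (r \o a)) /index_iota subn0. Qed.

Lemma level_set_diam n (f : {ffun 'I_n -> I}) x y :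
  level_set f x -> level_set f y -> `|x - y| <= \prod_i r (f i).
Proof.
move=> [a [ha af] <-] [b [hb bf] <-].
rewrite (eq_bigr (fun i : 'I_n => r (a i))) => [|i _]; last by rewrite af.
rewrite -ratio_mkseqE; apply: (coding_dist_le cX) => //.
by apply/mkseq_eqP => j jn; rewrite (af (Ordinal jn)) (bf (Ordinal jn)).
Qed.

Lemma level_set_sum n t : 0 <= t ->
  (\sum_(f : {ffun 'I_n -> I}) diam_pow t (level_set f) <=
   (pressure t ^+ n)%:E)%E.
Proof.
move=> t0.
have -> : pressure t ^+ n =
    \sum_(f in ffun_on (mem A)) \prod_(i < n) r (f i) `^ t.
  by rewrite -(bigA_distr_big _ (fun=> fun p => r p `^ t)) prodr_const card_ord.
rewrite -sumEFin [leRHS]big_mkcond /=; apply: lee_sum => f _.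
case: ifPn => [/ffun_onP fA|fA].
  have r0 i : 0 <= r (f i) by have /andP[/ltW] := coding_ratio cX (fA i).
  rewrite -powR_prod//; apply: diam_pow_le => //; first exact: prodr_ge0.
  by move=> x y; exact: level_set_diam.
suff -> : level_set f = set0 by rewrite diam_pow0.
apply/seteqP; split => // x [a [ha af] _]; apply: (negP fA).
by apply/ffun_onP => i; rewrite -af ha.
Qed.

(** The cylinders of level [n] have mesh tending to 0 and total cost at most [pressure t ^+ n],
    which vanishes in the limit. *)
Lemma coding_hausdorff_measure_eq0 t : 0 <= t -> pressure t < 1 ->
  hausdorff_measure t K = 0%E.
Proof.
move=> t0 P1; apply: hausdorff_measure_eq0 => e e0.
have [N1 hN1] := ratio_small cX e0.
have : (pressure t ^+ n @[n --> \oo] --> 0).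
  by apply: cvg_expr; rewrite ger0_norm// pressure_ge0.
move=> /cvgrPdist_lt /(_ _ e0)[N2 _ hN2].
pose n := maxn N1 N2.
exists (finite_family (@level_set n)); last first.
  rewrite sum_finite_family; [|exact: diam_pow0|exact: diam_pow_ge0].
  apply: le_trans (level_set_sum n t0) _; rewrite lee_fin.
  have := hN2 n (leq_maxr _ _); rewrite sub0r normrN ger0_norm; first exact: ltW.
  by rewrite exprn_ge0// pressure_ge0.
split=> [_ [a ha <-]|].
  exists (enum_rank [ffun i : 'I_n => a i]) => //.
  by rewrite finite_family_enum_rank; exists a => //; split => // i; rewrite ffunE.
apply: (finite_family_ind (P := fun U => (diam U <= e%:E)%E)) => [|f].
  by apply: diam_le.
apply: diam_le => x y fx fy; have [a [ha af] _] := fx.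
apply: le_trans (level_set_diam fx fy) _.
rewrite (eq_bigr (fun i : 'I_n => r (a i))) => [|i _]; last by rewrite af.
by rewrite -ratio_mkseqE ltW// hN1// leq_maxl.
Qed.

Lemma mass_ratio s w : {subset w <= A} ->
  mass (fun p => r p `^ s) w = ratio r w `^ s.
Proof.
move=> wA; rewrite /ratio big_seq powR_prod; last first.
  by move=> p /wA/(coding_ratio cX)/andP[/ltW].
by rewrite /mass big_seq.
Qed.

(* Take for [v] the longest common prefix of the sequences coding points of [U],
   cut short when there is at most one such sequence. *)
Lemma enclosing_cylinder s t e (U : set R) : 0 < s -> 0 <= t <= s -> 0 < e ->
  exists v : seq I, (forall a, adm a -> U (X a) -> cylinder A v a) /\
    ((mass (fun p => r p `^ s) v)%:E <=
      ((k `^ t)^-1)%:E * diam_pow t U + e%:E)%E.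
Proof.
move=> s0 /andP[t0 ts] e0.
have k0 := coding_gap_gt0 cX.
have kt0 : 0 < k `^ t by rewrite powR_gt0.
(* Two coded points of [U] separate at depth [n]; the least such [n] is the length of the common
   prefix. *)
pose P n := `[< exists a b, [/\ adm a /\ adm b, U (X a) /\ U (X b),
   mkseq a n = mkseq b n & a n != b n] >].
have [exP|nP] := pselect (exists n, P n).
  case: (ex_minnP exP) => n /asboolP[a [b [[ha hb] [Ua Ub] e_ab d_ab]]] minn.
  exists (mkseq a n); split.
    move=> d hd Ud; split => //; rewrite size_mkseq.
    have [->//|/eqP da] := pselect (d = a).
    have [l [dal dal']] := first_difference (elimN eqP da).
    have nl : (n <= l)%N by apply: minn; apply/asboolP; exists d, a.
    apply/mkseq_eqP => j jn; move/mkseq_eqP: dal => -> //.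
    exact: leq_trans jn nl.
  rewrite mass_ratio; last exact: mkseq_subset.
  have r0 := ratio_mkseq_gt0 cX n ha.
  have r1 : ratio r (mkseq a n) <= 1.
    rewrite ratio_mkseqE; apply: prodr_ile1 => i _.
    by have /andP[/ltW -> /ltW] := coding_ratio cX (ha i).
  apply: (@le_trans _ _ (((k `^ t)^-1)%:E * diam_pow t U)%E); last first.
    by rewrite leeDl// lee_fin ltW.
  (* With rho the ratio of the prefix, rho^s <= rho^t = k^-t (k rho)^t, and k rho is at most the
     distance between [X a] and [X b]. *)
  apply: (@le_trans _ _ (((k `^ t)^-1)%:E * ((k * ratio r (mkseq a n)) `^ t)%:E)%E).
    rewrite -EFinM lee_fin powRM ?(ltW k0) ?(ltW r0)// mulKf ?gt_eqF//.
    by rewrite ger_powR ?r0.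
  apply: lee_wpmul2l; first by rewrite lee_fin invr_ge0 ltW.
  apply: le_trans (le_diam_pow t0 Ua Ub); rewrite lee_fin.
  apply: ge0_ler_powR => //; rewrite ?nnegrE//.
    by rewrite mulr_ge0 ?(ltW k0) ?(ltW r0).
  exact: (coding_dist_ge cX).
have [a0 ha0] := admissible_nonempty A2.
have [a ha Ha] : exists2 a, adm a & forall d, adm d -> U (X d) -> d = a.
  have [[a [ha Ua]]|na] := pselect (exists a, adm a /\ U (X a)).
    exists a => // d hd Ud; apply: contrapT => da.
    have [l [dal dal']] := first_difference da.
    by apply: nP; exists l; apply/asboolP; exists d, a.
  by exists a0 => // d hd Ud; case: na; exists d.
(* A deep prefix of the only possible sequence works: a ratio below e^(1/s) makes its mass at most
   [e]. *)
have [n hn] := ratio_small cX (powR_gt0 s^-1 e0).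
exists (mkseq a n); split.
  by move=> d hd Ud; rewrite (Ha d hd Ud); exact: cylinder_mkseq.
rewrite mass_ratio; last exact: mkseq_subset.
apply: (@le_trans _ _ e%:E); last first.
  by rewrite leeDr// mule_ge0 ?diam_pow_ge0// lee_fin invr_ge0 ltW.
rewrite lee_fin -[leRHS]powRr1 ?(ltW e0)// -(mulVf (lt0r_neq0 s0)) powRrM.
apply: ge0_ler_powR; rewrite ?nnegrE ?powR_ge0 ?(ltW s0)//.
  by rewrite ltW// (ratio_mkseq_gt0 cX).
by rewrite ltW// hn.
Qed.

(** Each covering set is replaced by its enclosing cylinder. The masses total at least 1, of which
    the error terms use up at most half, hence the lower bound k^t / 2. *)
Lemma coding_hausdorff_measure_gt0 s t : 0 < s -> pressure s = 1 ->
  0 <= t <= s -> (0 < hausdorff_measure t K)%E.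
Proof.
move=> s0 Ps ts; have kt0 : 0 < k `^ t by rewrite powR_gt0// (coding_gap_gt0 cX).
apply: (@lt_le_trans _ _ (k `^ t / 2)%:E); first by rewrite lte_fin divr_gt0.
apply: hausdorff_measure_ge => U KU.
have e0 i : (0 : R) < 2^-1 / (2 ^ i.+1)%:R by rewrite divr_gt0// ltr0n expn_gt0.
have /choice[v hv] := fun i => enclosing_cylinder (U i) s0 ts (e0 i).
have : (1 <= \sum_(0 <= i <oo) (mass (fun p => r p `^ s) (v i))%:E)%E.
  apply: (@cylinder_cover_mass _ _ A) => [p|//|a ha]; first exact: powR_ge0.
  have [i _ Ui] : (\bigcup_i U i) (X a) by apply: KU; exists a.
  by exists i; apply: (hv i).1.
move=> h1; have {h1} : (1 <= \sum_(0 <= i <oo) (((k `^ t)^-1)%:E * diam_pow t (U i)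
    + (2^-1 / (2 ^ i.+1)%:R)%:E))%E.
  apply: le_trans h1 _; apply: lee_nneseries => i _; last exact: (hv i).2.
  by move=> _; rewrite lee_fin; apply: prodr_ge0 => p _; exact: powR_ge0.
have d0 i : (0 <= diam_pow t (U i))%E by exact: diam_pow_ge0.
have kV0 : (0 <= ((k `^ t)^-1)%:E)%E by rewrite lee_fin invr_ge0 ltW.
have h0 : (0 : R) <= 2^-1 by rewrite invr_ge0.
move=> /le_trans /(_ (epsilon_trick xpredT (fun i => mule_ge0 kV0 (d0 i)) h0)).
rewrite nneseriesZl//.
have : (0 <= \sum_(0 <= i <oo) diam_pow t (U i))%E by exact: nneseries_ge0.
case: (\sum_(0 <= i <oo) _)%E => [x| |]; last 2 first.
- by move=> _ _; rewrite leey.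
- by rewrite leNgt ltNy0.
rewrite -EFinM -EFinD -[1%E]/(1%:E) !lee_fin => x0 h.
have : 2^-1 <= (k `^ t)^-1 * x by lra.
by rewrite mulrC ler_pdivlMr// mulrC.
Qed.

Lemma coding_hausdorff_dim s : 0 < s -> pressure s = 1 ->
  hausdorff_dim K = s%:E.
Proof.
move=> s0 Ps; apply: hausdorff_dim_eq; first exact: ltW.
  move=> t st; apply: coding_hausdorff_measure_eq0.
    by rewrite ltW// (lt_trans s0).
  by rewrite -Ps; exact: pressure_lt.
move=> t /andP[t0 ts]; apply/eqP; rewrite gt_eqF//.
by apply: coding_hausdorff_measure_gt0 Ps _; rewrite // t0 ltW.
Qed.

Lemma coding_measurable : measurable K.
Proof. by apply: measurable_realfun.closed_measurable; exact: (coding_closed cX). Qed.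

Lemma coding_null : pressure 1 < 1 -> lebesgue_measure K = 0%E.
Proof.
move=> P1; apply: hausdorff_measure1_null; first exact: coding_measurable.
exact: coding_hausdorff_measure_eq0.
Qed.

Lemma coding_nowhere_dense : pressure 1 < 1 -> nowhere_dense K.
Proof.
move=> P1; rewrite /nowhere_dense -(closure_id K).1; last exact: (coding_closed cX).
apply/seteqP; split => // x /nbhs_ballP[e /= e0 eK].
suff : (lebesgue_measure (ball x e) <= 0)%E.
  by rewrite lebesgue_measure_ball ?(ltW e0)// lee_fin leNgt mulrn_wgt0.
rewrite -(coding_null P1); apply: le_measure => //; rewrite inE.
  by apply: measurable_realfun.open_measurable; exact: ball_open.
exact: coding_measurable.
Qed.

End CodingHausdorff.

(** * Regularity of recodings *)

Section TwoCodings.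
Context {R : realType} {I : finType} (A : {set I}).
Context (r c : I -> R) (k : R) (X : (nat -> I) -> R) (cX : coding A r c k X).
Context (r' c' : I -> R) (k' : R) (Y : (nat -> I) -> R).
Context (cY : coding A r' c' k' Y).
Context (G : R -> R) (GX : forall a, admissible A a -> G (X a) = Y a).
Implicit Types (a t : nat -> I).

Local Notation adm := (admissible A).
Local Notation K := (X @` adm).

(** Points coded closer than [k * ratio r (mkseq a n)] share the prefix of length [n], so their
    recodings are close too. *)
Lemma recoding_continuous : {within K, continuous G}.
Proof.
apply/subspace_continuousP => _ [a ha <-].
rewrite -[from_subspace K G]/G GX//.
apply/cvgrPdist_lt => e e0; rewrite near_withinE.
have [n hn] := ratio_small cY e0.
have d0 : 0 < k * ratio r (mkseq a n).
  by rewrite mulr_gt0 ?(coding_gap_gt0 cX)// (ratio_mkseq_gt0 cX).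
exists (k * ratio r (mkseq a n)) => //= y ay [b hb by_]; move: ay; rewrite -by_ GX// => ab.
have [->|/eqP nab] := eqVneq a b; first by rewrite subrr normr0.
have [m [abm dm]] := first_difference nab.
have nm : (n <= m)%N.
  rewrite leqNgt; apply/negP => mn; move: ab; apply/negP; rewrite -leNgt.
  apply: le_trans (coding_dist_ge cX ha hb abm dm).
  rewrite ler_pM2l ?(coding_gap_gt0 cX)// -(subnK mn).
  elim: (n - m.+1)%N => [|j IH].
    rewrite add0n ratio_mkseqS ler_piMr ?(ltW (ratio_mkseq_gt0 cX _ ha))//.
    by have /andP[_ /ltW] := coding_ratio cX (ha m).
  apply: le_trans IH; rewrite addSn ratio_mkseqS.
  rewrite ler_piMr ?(ltW (ratio_mkseq_gt0 cX _ ha))//.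
  by have /andP[_ /ltW] := coding_ratio cX (ha (j + m.+1)%N).
apply: le_lt_trans (hn n a (leqnn _) ha); apply: (coding_dist_le cY) => //.
apply/mkseq_eqP => j jn; move/mkseq_eqP: abm => -> //.
exact: leq_trans jn nm.
Qed.

Hypothesis A2 : (1 < #|A|)%N.
Variable p0 : I.
Hypothesis ratio_p0 : r p0 = r' p0.
Hypothesis ratio_other : forall p, p \in A -> p != p0 -> 2 * r p <= r' p.

(* The difference quotients along a cylinder of depth [n] are scaled by
   [ratio r' / ratio r], so they are unbounded unless the sequence is eventually
   constant [p0]; and then exact scaling would make [G] affine on [K], which the
   branch of a letter other than [p0] contradicts. *)
Lemma recoding_not_derivable x : K x -> ~ derivable_on K G x.
Proof.
move=> [a ha <-] [l /cvgrPdist_lt hl].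
pose kap n := ratio r' (mkseq a n) / ratio r (mkseq a n).
have k0 n : 0 < kap n by rewrite divr_gt0 ?(ratio_mkseq_gt0 cX)// (ratio_mkseq_gt0 cY).
(* Approaching [X a] along sequences that keep its first [n] letters and continue with [t] turns the
   difference quotient into [kap n] times the quotient of the tails. *)
have near_l e : 0 < e -> exists N, forall n t, (N <= n)%N -> adm t ->
    t <> shiftn n a ->
    `|l - kap n * ((Y t - Y (shiftn n a)) / (X t - X (shiftn n a)))| < e.
  move=> e0; have := hl e e0; rewrite near_withinE => -[d /= d0 hd].
  have [N hN] := ratio_small cX d0; exists N => n t Nn ht tn.
  have hs : adm (splice a n t) by exact: splice_admissible.
  have hsa : adm (shiftn n a) by exact: shiftn_admissible.
  have es := mkseq_splice a n t.
  have nt : X t - X (shiftn n a) != 0.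
    by rewrite subr_eq0; apply/eqP => /(coding_inj cX ht hsa).
  have rn0 : ratio r (mkseq a n) != 0 by rewrite gt_eqF// (ratio_mkseq_gt0 cX).
  have eX := coding_diff cX hs ha es; have eY := coding_diff cY hs ha es.
  rewrite es shiftn_splice in eX; rewrite es shiftn_splice in eY.
  have Xne : X (splice a n t) != X a by rewrite -subr_eq0 eX mulf_neq0.
  have := hd (X (splice a n t)); rewrite !GX// eX eY.
  rewrite (_ : _ / _ = kap n * ((Y t - Y (shiftn n a)) / (X t - X (shiftn n a)))).
    apply => //=; last by exists (splice a n t).
    rewrite distrC; apply: le_lt_trans (hN n a Nn ha).
    by rewrite -es; apply: (coding_dist_le cX).
  by rewrite /kap; field; rewrite rn0 nt.
have kapS n : kap n.+1 = kap n * (r' (a n) / r (a n)).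
  rewrite /kap !ratio_mkseqS; field.
  rewrite !gt_eqF// ?(ratio_mkseq_gt0 cX)//.
  by have /andP[] := coding_ratio cX (ha n).
have rpos n : 0 < r (a n) by have /andP[] := coding_ratio cX (ha n).
have kap_p0 n : a n = p0 -> kap n.+1 = kap n.
  by move=> e; rewrite kapS e -ratio_p0 -e divff ?mulr1// gt_eqF.
have kap2 n : a n != p0 -> 2 * kap n <= kap n.+1.
  move=> e; rewrite kapS mulrC ler_pM2l// ler_pdivlMr//.
  exact: ratio_other.
have kap_mono n m : (n <= m)%N -> kap n <= kap m.
  move/subnK <-; elim: (m - n)%N => [|j IH]; first by rewrite add0n.
  apply: le_trans IH _; rewrite addSn.
  have [/kap_p0 ->//|/kap2] := eqVneq (a (j + n)%N) p0.
  by have := k0 (j + n)%N; lra.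
have [N hN] := near_l 1 ltr01.
(* A tail with another first letter has [Y]-difference at least [k'] and [X]-difference at most 1,
   so a finite limit bounds [kap]. *)
have kap_bound n : kap n <= (`|l| + 1) / k'.
  apply: le_trans (kap_mono _ _ (leq_maxl n N)) _; set m := maxn n N.
  have [p pA pa] := other_digit A2 (a m).
  pose t : nat -> I := fun=> p.
  have ht : adm t by [].
  have hsa : adm (shiftn m a) by exact: shiftn_admissible.
  have t0 : t 0%N != shiftn m a 0%N by rewrite /shiftn addn0.
  have tn : t <> shiftn m a by move=> e; rewrite e eqxx in t0.
  have := hN m t (leq_maxr _ _) ht tn.
  set z := _ / (X t - _) => hz.
  have z1 : k' <= `|z|.
    rewrite /z normrM normfV ler_pdivlMr; last first.
      rewrite normr_gt0 subr_eq0; apply/eqP => /(coding_inj cX ht hsa).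
      exact: tn.
    apply: le_trans (coding_gap cY ht hsa t0).
    by rewrite ler_piMr ?(ltW (coding_gap_gt0 cY))// (coding_dist1 cX).
  rewrite ler_pdivlMr ?(coding_gap_gt0 cY)//.
  apply: (@le_trans _ _ `|kap m * z|).
    by rewrite normrM (gtr0_norm (k0 m)) ler_pM2l.
  rewrite -[X in `|X| <= _](subKr l); apply: le_trans (ler_normB _ _) _.
  by rewrite lerD2l ltW.
(* Every letter other than [p0] at least doubles [kap], so a bounded [kap] allows only finitely many
   of them. *)
have [N' tail] : exists N', forall n, (N' <= n)%N -> a n = p0.
  apply: contrapT => /forallNP h.
  have big j : exists n, 2 ^+ j * kap 0 <= kap n.
    elim: j => [|j [n hn]]; first by exists 0%N; rewrite expr0 mul1r.
    have /existsNP[m /not_implyP[nm /eqP am]] := h n.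
    exists m.+1; apply: le_trans (kap2 _ am); rewrite exprS -mulrA.
    by rewrite ler_pM2l// (le_trans hn)// kap_mono.
  pose M := (`|l| + 1) / k' / kap 0.
  have [n hn] := big (Num.Def.archi_bound M).
  have := le_trans hn (kap_bound n); rewrite -ler_pdivlMr// -/M leNgt.
  move=> /negP; apply; apply: (@lt_trans _ _ (Num.Def.archi_bound M)%:R).
    apply: archi_boundP; apply: divr_ge0; last exact: ltW.
    by rewrite divr_ge0 ?addr_ge0 ?(ltW (coding_gap_gt0 cY)).
  by rewrite -natrX ltr_nat ltn_expl.
have kapE n : (N' <= n)%N -> kap n = kap N'.
  move/subnK <-; elim: (n - N')%N => [|j IH]; first by rewrite add0n.
  by rewrite addSn kap_p0// tail// leq_addl.
pose o : nat -> I := fun=> p0.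
have shiftE n : (N' <= n)%N -> shiftn n a = o.
  move=> n0; apply/funext => j; rewrite /shiftn tail//.
  exact: leq_trans n0 (leq_addr _ _).
have ho : adm o by move=> n; rewrite /o -(tail N')// ha.
(* Beyond [N'] the tail [o] and the factor [kap] no longer change, so the approximation of [l] is an
   equality. *)
have affine t : adm t -> kap N' * (Y t - Y o) = l * (X t - X o).
  move=> ht; have [->|/eqP to] := eqVneq t o; first by rewrite !subrr !mulr0.
  have nt : X t - X o != 0.
    by rewrite subr_eq0; apply/eqP => /(coding_inj cX ht ho).
  suff -> : l = kap N' * ((Y t - Y o) / (X t - X o)) by field.
  apply/eqP; rewrite -subr_eq0 -normr_le0; apply/ler_addgt0Pr => e e0.
  have [m hm] := near_l e e0.
  have := hm (maxn m N') t (leq_maxl _ _) ht.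
  by rewrite shiftE ?leq_maxr// kapE ?leq_maxr// add0r => /(_ to)/ltW.
(* Prefixing [b] to [s] and [o] scales the [Y]-difference by [r' b] and the [X]-difference by [r b];
   the affine relation before and after forces these ratios to be equal. *)
have [b bA b0] := other_digit A2 p0.
pose s : nat -> I := fun=> b.
have hs : adm s by [].
have hos : Y s != Y o.
  apply/eqP => /(coding_inj cY hs ho) /(congr1 (fun f => f 0%N)) /eqP.
  by rewrite (negbTE b0).
have hbs t : adm t -> adm (splice s 1 t) by move=> ht; exact: splice_admissible.
have eb t : mkseq (splice s 1 t) 1 = [:: b] by rewrite mkseq_splice.
have e1 : mkseq (splice s 1 s) 1 = mkseq (splice s 1 o) 1 by rewrite !eb.
have eX := coding_diff cX (hbs _ hs) (hbs _ ho) e1.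
have eY := coding_diff cY (hbs _ hs) (hbs _ ho) e1.
rewrite eb !shiftn_splice /ratio big_seq1 in eX.
rewrite eb !shiftn_splice /ratio big_seq1 in eY.
have E1 := affine _ hs; have E2 := affine _ (hbs _ hs); have E3 := affine _ (hbs _ ho).
have : kap N' * (r' b * (Y s - Y o)) = l * (r b * (X s - X o)).
  rewrite -eX -eY; transitivity (kap N' * (Y (splice s 1 s) - Y o)
    - kap N' * (Y (splice s 1 o) - Y o)); first by ring.
  by rewrite E2 E3; ring.
rewrite (mulrCA l) -E1 => E.
have : kap N' * (Y s - Y o) * (r' b - r b) = 0.
  by rewrite mulrBr -mulrA (mulrC (Y s - Y o)) E; ring.
have rb : r' b - r b != 0.
  have := ratio_other bA b0; have /andP[] := coding_ratio cX bA.
  by move=> rb0 _ rb2; rewrite gt_eqF//; lra.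
apply/eqP; apply: mulf_neq0 rb; apply: mulf_neq0; first by rewrite gt_eqF.
by rewrite subr_eq0.
Qed.

End TwoCodings.

(** * Expansions in base q *)

Section DigitExpansions.
Context {R : realType} (q : nat) (hq : (1 < q)%N).
Implicit Types (d : nat -> 'I_q).

Let q0 : (0 : R) < q%:R. Proof. by rewrite ltr0n ltnW. Qed.
Let qV0 : (0 : R) < q%:R^-1. Proof. by rewrite invr_gt0. Qed.

(** A digit is at most [q - 1]; the telescoping bound then keeps all expansions below or equal to
    1. *)
Lemma digit_term_le (p : 'I_q) n :
  p%:R / q%:R ^+ n.+1 <= q%:R^-1 ^+ n - q%:R^-1 ^+ n.+1 :> R.
Proof.
rewrite -exprVn !exprS mulrA -{2}(mul1r (_ ^+ n)) -mulrBl.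
rewrite ler_wpM2r ?exprn_ge0 ?(ltW qV0)// ler_pdivrMr// mulrBl mulVf ?gt_eqF//.
by rewrite mul1r lerBrDr natr1 ler_nat.
Qed.

Lemma cvg_Delta d :
  series (fun n => (d n)%:R / q%:R ^+ n.+1 : R) @ \oo --> (Delta d : R).
Proof.
apply: (@series_le_cvg _ _ (geometric 1 q%:R^-1)) => [n|n|n|].
- by rewrite divr_ge0// exprn_ge0// ltW.
- by rewrite /geometric/= mul1r exprn_ge0// ltW.
- rewrite /geometric/= mul1r; apply: le_trans (digit_term_le _ _) _.
  by rewrite gerBl exprn_ge0// ltW.
- by apply: is_cvg_geometric_series; rewrite ger0_norm ?(ltW qV0)// invf_lt1// ltr1n.
Qed.

Lemma Delta_ge0 d : 0 <= Delta d :> R.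
Proof.
apply: (@closed_cvg _ _ _ eventually_filter _ (fun x : R => 0 <= x) _ _ _ (@cvg_Delta d)).
  exact: closed_ge.
by apply: nearW => n; rewrite /series/=; apply: sumr_ge0 => i _; rewrite divr_ge0// exprn_ge0// ltW.
Qed.

Lemma Delta_le1 d : Delta d <= 1 :> R.
Proof.
apply: (@closed_cvg _ _ _ eventually_filter _ (fun x : R => x <= 1) _ _ _ (@cvg_Delta d)).
  exact: closed_le.
apply: nearW => n; rewrite seriesEord.
suff : \sum_(i < n) (d i)%:R / q%:R ^+ i.+1 <= 1 - q%:R^-1 ^+ n :> R.
  by move=> /le_trans; apply; rewrite gerBl exprn_ge0// ltW.
elim: n => [|n IH]; first by rewrite big_ord0 expr0 subrr.
rewrite big_ord_recr/=; apply: le_trans (lerD IH (digit_term_le _ _)) _.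
by rewrite addrA subrK.
Qed.

Lemma Delta_rec d : Delta d = (d 0%N)%:R / q%:R + Delta (sigma d) / q%:R :> R.
Proof.
have h := @cvg_Delta (sigma d).
have h1 : (fun n => (d 0%N)%:R / q%:R +
   series (fun n => (sigma d n)%:R / q%:R ^+ n.+1) n / q%:R) @ \oo -->
   ((d 0%N)%:R / q%:R + Delta (sigma d) / q%:R : R).
  by apply: cvgD; [exact: cvg_cst|apply: cvgMl].
have h2 : (fun n => series (fun n => (d n)%:R / q%:R ^+ n.+1 : R) n.+1) @ \oo -->
    (Delta d : R).
  by rewrite (cvg_shiftS (series (fun n => (d n)%:R / q%:R ^+ n.+1 : R))); exact: cvg_Delta.
apply: (cvg_unique _ h2) => //.
suff -> : (fun n => series (fun n => (d n)%:R / q%:R ^+ n.+1 : R) n.+1) =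
   (fun n => (d 0%N)%:R / q%:R +
   series (fun n => (sigma d n)%:R / q%:R ^+ n.+1) n / q%:R) by exact: h1.
apply/funext => n; rewrite !seriesEord /= big_ord_recl /= expr1; congr (_ + _).
rewrite mulr_suml; apply: eq_bigr => i _.
by rewrite /sigma /bump/= add1n -mulrA -invfM -exprSr.
Qed.

Lemma iter_sigma n d : iter n (@sigma q) d = shiftn n d.
Proof.
elim: n => [|n IH]; first by rewrite shiftn0.
by rewrite iterS IH -shiftnS.
Qed.

Lemma Delta_unroll n d : Delta d =
  \sum_(j < n) (d j)%:R / q%:R ^+ j.+1 + q%:R^-1 ^+ n * Delta (shiftn n d) :> R.
Proof.
elim: n => [|n IH]; first by rewrite big_ord0 add0r expr0 mul1r shiftn0.
rewrite {}IH Delta_rec big_ord_recr /= -addrA; congr (_ + _).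
rewrite -[sigma _]/(shiftn 1 (shiftn n d)) shiftnS /shiftn addn0.
by rewrite -[(q%:R ^+ n.+1)^-1]exprVn !exprSr; ring.
Qed.

Lemma Delta_ge_digit d n : (0 < d n)%N -> q%:R^-1 ^+ n.+1 <= Delta d :> R.
Proof.
move=> dn; rewrite (Delta_unroll n.+1) big_ord_recr/=.
apply: (@le_trans _ _ ((d n)%:R / q%:R ^+ n.+1)).
  by rewrite exprVn ler_peMl ?invr_ge0 ?exprn_ge0 ?ler1n// ltW.
rewrite -addrA addrCA lerDl addr_ge0//.
  by apply: sumr_ge0 => i _; rewrite divr_ge0// exprn_ge0// ltW.
by rewrite mulr_ge0 ?exprn_ge0 ?Delta_ge0// ltW.
Qed.

(** An excess of at least one unit at digit [n] pays for the whole tail of [d'], worth at most one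
    unit; the tail of [d] is left over. *)
Lemma Delta_gap d d' n : (forall j, (j < n)%N -> d j = d' j) -> (d' n < d n)%N ->
  q%:R^-1 ^+ n.+1 * Delta (shiftn n.+1 d) <= Delta d - Delta d' :> R.
Proof.
move=> e lt; rewrite (Delta_unroll n.+1 d) (Delta_unroll n.+1 d').
rewrite !big_ord_recr/= (eq_bigr (fun j : 'I_n => (d' j)%:R / q%:R ^+ j.+1)); last first.
  by move=> j _; rewrite e.
set S := \sum_(_ < _) _; set T := q%:R^-1 ^+ n.+1.
have -> : (q%:R ^+ n.+1)^-1 = T :> R by rewrite /T exprVn.
have T0 : 0 < T by rewrite exprn_gt0.
have := Delta_le1 (shiftn n.+1 d'); move: (Delta (shiftn n.+1 d)) => x.
move: (Delta _) => y y1.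
have : (d' n)%:R + 1 <= (d n)%:R :> R by rewrite natr1 ler_nat.
move: (d n)%:R (d' n)%:R => v v' dd.
rewrite -subr_ge0 (_ : _ - _ = T * (v - v' - y)); last by ring.
by rewrite mulr_ge0 ?(ltW T0)//; lra.
Qed.

End DigitExpansions.

(** * The block and digit codings, and the monotonicity of [g] *)

Section BlockExpansions.
Context {R : realType} (q : nat) (u : 'I_q) (hq : (3 < q)%N).
Implicit Types (a b : nat -> 'I_q).

Local Notation V := (q%:R^-1 : R).

Let q1 : (1 < q)%N. Proof. by apply: leq_trans hq. Qed.
Let q0 : (0 : R) < q%:R. Proof. by rewrite ltr0n ltnW. Qed.
Let V0 : 0 < V. Proof. by rewrite invr_gt0. Qed.
Let V1 : V < 1. Proof. by rewrite invf_lt1// ltr1n. Qed.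

Lemma Theta_gt0 (p : 'I_q) : p \in Theta u -> (0 < p)%N.
Proof. by rewrite inE => /andP[]. Qed.

Lemma block_index a j : Theta_seq u a ->
  exists n i, j = (\sum_(l < n) a l + i)%N /\ (i < a n)%N.
Proof.
move=> ha; elim: j => [|j [n [i [-> hi]]]].
  by exists 0%N, 0%N; rewrite big_ord0; split => //; exact: Theta_gt0.
have [lt|ge] := ltnP i.+1 (a n); first by exists n, i.+1; rewrite addnS.
exists n.+1, 0%N; split; last exact: Theta_gt0.
have e : i.+1 = a n by apply/eqP; rewrite eqn_leq hi ge.
by rewrite big_ord_recr/= -addnS e addn0.
Qed.

Lemma shiftn_blocks a : Theta_seq u a ->
  shiftn (a 0%N) (blocks u a) = blocks u (sigma a).
Proof.
move=> ha; have hs : Theta_seq u (sigma a) by move=> n; exact: ha.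
apply/funext => j; have [n [i [-> hi]]] := block_index j hs.
rewrite (blocksE hs hi) /shiftn addnA.
have -> : (a 0%N + \sum_(l < n) sigma a l = \sum_(l < n.+1) a l)%N.
  by rewrite big_ord_recl.
by rewrite blocksE.
Qed.

Lemma shiftn_sum_blocks a n : Theta_seq u a ->
  shiftn (\sum_(i < n) a i) (blocks u a) = blocks u (shiftn n a).
Proof.
elim: n a => [|n IH] a ha; first by rewrite big_ord0 !shiftn0.
have hs : Theta_seq u (sigma a) by move=> m; exact: ha.
rewrite big_ord_recl/=.
transitivity (shiftn (\sum_(i < n) sigma a i) (shiftn (a 0%N) (blocks u a))).
  by apply/funext => j; rewrite /shiftn addnA.
by rewrite shiftn_blocks// IH.
Qed.

Lemma blocks_head a j : Theta_seq u a -> (j < a 0)%N ->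
  blocks u a j = if j == (a 0%N).-1 then a 0%N else u.
Proof. by move=> ha hj; have := blocksE ha hj; rewrite big_ord0 add0n. Qed.

Definition block_offset (p : 'I_q) : R :=
  \sum_(j < p) (if j == p.-1 :> nat then p else u)%:R / q%:R ^+ j.+1.

(** The nonzero digit that provides the gap lies within the first two blocks, each shorter than
    [q]. *)
Definition block_gap : R := V ^+ (2 * q).

Lemma Vexp_le m n : (m <= n)%N -> V ^+ n <= V ^+ m.
Proof. by move=> mn; rewrite ler_wiXn2l// ltW. Qed.

Lemma Delta_blocks_ge a : Theta_seq u a ->
  V ^+ (a 0%N) <= Delta (blocks u a) :> R.
Proof.
move=> ha; have a0 := Theta_gt0 (ha 0%N).
have := @Delta_ge_digit R q q1 (blocks u a) (a 0%N).-1.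
by rewrite prednK// => -> //; rewrite blocks_head ?eqxx ?prednK.
Qed.

(** The expansions first differ at the end of the shorter block, where [a] shows the digit [a 0] and
    [b] still shows [u]; comparing these two digits decides the order. *)
Lemma blocks_gap a b : Theta_seq u a -> Theta_seq u b -> (a 0 < b 0)%N ->
  if (u < a 0%N)%N then block_gap <= Delta (blocks u a) - Delta (blocks u b) :> R
  else block_gap <= Delta (blocks u b) - Delta (blocks u a) :> R.
Proof.
move=> ha hb ab.
have a0 := Theta_gt0 (ha 0%N); have b0 := Theta_gt0 (hb 0%N).
have pa : (a 0).-1.+1 = a 0%N by rewrite prednK.
have lt_b : ((a 0).-1 < (b 0).-1)%N by rewrite -ltnS !prednK.
have da : blocks u a (a 0).-1 = a 0%N by rewrite blocks_head ?eqxx ?pa.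
have db : blocks u b (a 0).-1 = u.
  by rewrite blocks_head ?(ltn_eqF lt_b)// pa ltnW.
have agree j : (j < (a 0).-1)%N -> blocks u a j = blocks u b j.
  move=> ja; have ja' : (j < a 0)%N by rewrite -pa ltnW.
  rewrite !blocks_head// ?(ltn_trans ja')// (ltn_eqF ja) ltn_eqF//.
  exact: ltn_trans ja lt_b.
case: ifPn => [ua|ua].
  (* The surplus is the tail of [a], whose next block ends in the nonzero digit [a 1]. *)
  have := @Delta_gap R q q1 (blocks u a) (blocks u b) (a 0).-1 agree.
  rewrite da db => /(_ ua); apply: le_trans; rewrite pa shiftn_blocks//.
  apply: (@le_trans _ _ (V ^+ a 0%N * V ^+ a 1%N)).
    by rewrite -exprD Vexp_le// mul2n -addnn leq_add// ltnW.
  rewrite ler_pM2l ?exprn_gt0//; apply: (@Delta_blocks_ge (sigma a)).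
  by move=> n; exact: ha.
have ua' : (a 0 < u)%N.
  rewrite ltn_neqAle leqNgt ua andbT.
  by have := ha 0%N; rewrite inE => /andP[_]; apply: contra => /eqP/val_inj ->.
have := @Delta_gap R q q1 (blocks u b) (blocks u a) (a 0).-1 (fun j h => esym (agree j h)).
rewrite da db => /(_ ua'); apply: le_trans; rewrite pa.
(* Here the surplus contains the rest of the first block of [b], which ends in the nonzero digit
   [b 0]. *)
have hd : (0 < shiftn (a 0) (blocks u b) ((b 0).-1 - a 0))%N.
  rewrite /shiftn subnKC; last by rewrite -ltnS prednK.
  by rewrite blocks_head ?eqxx// prednK.
apply: (@le_trans _ _ (V ^+ a 0%N * V ^+ ((b 0).-1 - a 0).+1)); last first.
  by rewrite ler_pM2l ?exprn_gt0//; exact: Delta_ge_digit.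
rewrite -exprD Vexp_le//.
rewrite addnS subnKC; last by rewrite -ltnS prednK.
by rewrite prednK// (leq_trans (ltnW (ltn_ord _)))// mul2n -addnn leq_addr.
Qed.

Lemma blocks_coding : coding (Theta u) (fun p => V ^+ p) block_offset block_gap
  (fun a => Delta (blocks u a)).
Proof.
split.
- move=> p pT; rewrite exprn_gt0//= exprn_ilt1// ?ltW// -lt0n.
  exact: Theta_gt0.
- move=> a ha; rewrite (@Delta_unroll R q q1 (a 0%N)) shiftn_blocks//.
  rewrite /block_offset; congr (_ + _); apply: eq_bigr => j _.
  by rewrite blocks_head.
- by move=> a _; rewrite Delta_ge0// Delta_le1.
- by rewrite exprn_gt0.
- move=> a b ha hb ab.
  wlog lt : a b ha hb ab / (a 0 < b 0)%N.
    move=> h; have [/h|ge] := ltnP (a 0%N) (b 0%N); first exact.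
    rewrite distrC; apply: h => //; first by rewrite eq_sym.
    by rewrite ltn_neqAle ge andbT eq_sym.
  have := blocks_gap ha hb lt; case: ifP => _ h; apply: le_trans h _.
    exact: ler_norm.
  by rewrite distrC ler_norm.
Qed.

(** The surplus comes from the second digit of [b], nonzero because 0 is not in [Theta]. *)
Lemma Delta_lt_gap a b : Theta_seq u a -> Theta_seq u b -> (a 0 < b 0)%N ->
  V ^+ 2 <= Delta b - Delta a :> R.
Proof.
move=> ha hb ab; have := @Delta_gap R q q1 b a 0 (fun j h => False_ind _ (notF h)) ab.
apply: le_trans; rewrite exprS expr1 ler_pM2l//.
by apply: (@Delta_ge_digit R q q1 (shiftn 1 b) 0); exact: Theta_gt0 (hb 1%N).
Qed.

Lemma Delta_coding : coding (Theta u) (fun=> V) (fun p : 'I_q => p%:R * V) (V ^+ 2)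
  (fun a : nat -> 'I_q => Delta a).
Proof.
split.
- by move=> p _; rewrite V0 V1.
- by move=> a _; rewrite (Delta_rec q1) mulrC [X in _ + X]mulrC mulrC.
- by move=> a _; rewrite Delta_ge0// Delta_le1.
- by rewrite exprn_gt0.
- move=> a b ha hb ab.
  have [lt|ge] := ltnP (a 0%N) (b 0%N).
    by rewrite distrC; apply: le_trans (Delta_lt_gap ha hb lt) (ler_norm _).
  apply: le_trans (ler_norm _); apply: Delta_lt_gap => //.
  by rewrite ltn_neqAle ge andbT eq_sym.
Qed.

Lemma card_Theta_gt1 : (1 < #|Theta u|)%N.
Proof.
have h1 : (1 < q)%N by []; have h2 : (2 < q)%N by exact: ltnW.
apply/card_gt1P; have [u1|u1] := eqVneq (val u) 1%N.
  by exists (Ordinal h2), (Ordinal hq); rewrite !inE -!val_eqE /= u1.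
have [u2|u2] := eqVneq (val u) 2%N.
  by exists (Ordinal h1), (Ordinal hq); rewrite !inE -!val_eqE /= u2.
by exists (Ordinal h1), (Ordinal h2); rewrite !inE -!val_eqE /= eq_sym u1 eq_sym u2.
Qed.

Lemma card_Theta_lt : (#|Theta u| < q)%N.
Proof.
have q0' : (0 < q)%N by exact: ltnW.
rewrite -[X in (_ < X)%N]card_ord -cardsT proper_card//.
rewrite properT; apply/negP => /eqP/setP/(_ (Ordinal q0')).
by rewrite !inE.
Qed.

Lemma g_graph_blocks a (y : R) : Theta_seq u a ->
  g_graph u (Delta (blocks u a)) y <-> y = Delta a.
Proof.
move=> ha; split=> [[b [hb e ->]]|->]; last by exists a.
by rewrite (coding_inj blocks_coding ha hb e).
Qed.

Lemma g_blocks a : Theta_seq u a -> g u (Delta (blocks u a)) = Delta a :> R.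
Proof.
move=> ha; apply/(g_graph_blocks _ ha); apply: getPex.
by exists (Delta a); apply/g_graph_blocks.
Qed.

(** A common prefix scales differences by positive factors, so the first different letters decide
    both orders: digit expansions follow the letters, block expansions reverse them exactly when
    both letters exceed [u]. *)
Lemma first_difference_signs a b : Theta_seq u a -> Theta_seq u b ->
    Delta (blocks u a) < Delta (blocks u b) :> R ->
  exists n, [/\ a n != b n,
    ((a n < b n)%N = (Delta a < Delta b :> R)) &
    ((a n < b n)%N = ~~ (u < minn (a n) (b n))%N)].
Proof.
move=> ha hb lt.
have ab : a <> b by move=> e; rewrite e ltxx in lt.
have [n [en dn]] := first_difference ab; exists n.
have hna : Theta_seq u (shiftn n a) by move=> m; exact: ha.
have hnb : Theta_seq u (shiftn n b) by move=> m; exact: hb.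
have rX := ratio_mkseq_gt0 blocks_coding n ha.
have rY := ratio_mkseq_gt0 Delta_coding n ha.
have eX := coding_diff blocks_coding ha hb en.
have eY := coding_diff Delta_coding ha hb en.
have ltX : Delta (blocks u (shiftn n a)) < Delta (blocks u (shiftn n b)) :> R.
  by move: lt; rewrite -subr_lt0 eX pmulr_rlt0// subr_lt0.
have ltY : (Delta a < Delta b :> R) = (Delta (shiftn n a) < Delta (shiftn n b) :> R).
  by rewrite -subr_lt0 eY pmulr_rlt0// subr_lt0.
have sX := @blocks_gap (shiftn n a) (shiftn n b) hna hnb.
have sX' := @blocks_gap (shiftn n b) (shiftn n a) hnb hna.
have sY := @Delta_lt_gap (shiftn n a) (shiftn n b) hna hnb.
have sY' := @Delta_lt_gap (shiftn n b) (shiftn n a) hnb hna.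
have g0 : 0 < block_gap by rewrite exprn_gt0.
have V20 : 0 < V ^+ 2 by rewrite exprn_gt0.
have s0 (d : nat -> 'I_q) : shiftn n d 0 = d n by rewrite /shiftn addn0.
rewrite ltY; move: sX sX' sY sY'; rewrite !s0.
have [lt_ab|lt_ba|e] := ltngtP (a n) (b n); last by move: dn; rewrite -val_eqE /= e eqxx.
  move=> /(_ isT) sX _ /(_ isT) sY _; split => //.
    by apply/esym; lra.
  by move: sX; case: ifP => // _; lra.
move=> _ /(_ isT) sX _ /(_ isT) sY; split => //.
  by apply/esym/negbTE; rewrite -leNgt; lra.
by move: sX; case: ifP => // _; lra.
Qed.

(** Every letter of [Theta] exceeds such a [u], so the order is always reversed. *)
Lemma g_decreasing : (u <= 1)%N -> decreasing_on (Dg u) (g u : R -> R).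
Proof.
move=> u1 _ _ [a ha <-] [b hb <-] lt; rewrite !g_blocks//.
have [n [ab eD eu]] := first_difference_signs ha hb lt.
have nlt : ~~ (a n < b n)%N.
  apply/negP => lt_ab; move: (lt_ab); rewrite eu /minn lt_ab -leqNgt => au.
  have := ha n; rewrite inE => /andP[a0 /negP]; apply; apply/eqP/val_inj => /=.
  by apply/eqP; rewrite eqn_leq au (leq_trans u1).
rewrite lt_neqAle leNgt -eD nlt andbT.
by apply/eqP => /(coding_inj Delta_coding hb ha) e; rewrite e eqxx in ab.
Qed.

(** Two different letters above [u] would require [u + 2 < q], so the order is never reversed. *)
Lemma g_increasing : (q - 2 <= u)%N -> increasing_on (Dg u) (g u : R -> R).
Proof.
move=> u1 _ _ [a ha <-] [b hb <-] lt; rewrite !g_blocks//.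
have [n [ab eD eu]] := first_difference_signs ha hb lt.
rewrite -eD eu -leqNgt leqNgt; apply/negP => um.
have : (minn (a n) (b n) < maxn (a n) (b n))%N.
  by case: (ltngtP (a n) (b n)) => // e; move: ab; rewrite -val_eqE /= e eqxx.
have : (maxn (a n) (b n) < q)%N by rewrite gtn_max !ltn_ord.
move: u1 um; lia.
Qed.

(** Constant sequences suffice: between the letters 1 and [u + 1] the order is kept, between [u + 1]
    and [u + 2] it is reversed. *)
Lemma g_not_monotonic : (2 <= u <= q - 3)%N -> ~ monotonic_on (Dg u) (g u : R -> R).
Proof.
move=> /andP[u2 u3].
have h1 : (1 < q)%N by [].
have hu1 : (u.+1 < q)%N by lia.
have hu2 : (u.+2 < q)%N by lia.
pose a (p : 'I_q) : nat -> 'I_q := fun=> p.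
have hT (p : 'I_q) : (0 < p)%N -> p != u :> nat -> Theta_seq u (a p).
  by move=> p0 pu n; rewrite inE p0 -val_eqE.
have t1 : Theta_seq u (a (Ordinal h1)) by apply: hT => //=; lia.
have t2 : Theta_seq u (a (Ordinal hu1)) by apply: hT => //=; lia.
have t3 : Theta_seq u (a (Ordinal hu2)) by apply: hT => //=; lia.
have D (p : 'I_q) : Theta_seq u (a p) -> Dg u (Delta (blocks u (a p)) : R).
  by move=> h; exists (a p).
have g0 : 0 < block_gap by rewrite exprn_gt0.
have V20 : 0 < V ^+ 2 by rewrite exprn_gt0.
have l12 : (1 < u.+1)%N by lia.
have := blocks_gap t1 t2 l12; rewrite ifF; last by apply/negbTE; rewrite /=; lia.
have := blocks_gap t2 t3 (ltnSn _); rewrite ifT; last by rewrite /=.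
have := Delta_lt_gap t1 t2 l12; have := Delta_lt_gap t2 t3 (ltnSn _).
move=> y23 y12 x23 x12 [] mono.
  have := mono _ _ (D _ t3) (D _ t2); rewrite !g_blocks//; lra.
have := mono _ _ (D _ t1) (D _ t2); rewrite !g_blocks//; lra.
Qed.

(** * The dimension equations of domain and range *)

Lemma pressure_blocks1 : pressure (Theta u) (fun p => V ^+ p) 1 < 1.
Proof.
apply: (@le_lt_trans _ _ (\sum_(p in Theta u) V)).
  apply: ler_sum => p /Theta_gt0 p0; rewrite powRr1 ?exprn_ge0 ?(ltW V0)//.
  by rewrite -[leRHS]expr1 Vexp_le.
by rewrite sumr_const -[V *+ _]mulr_natl ltr_pdivrMr// mul1r ltr_nat card_Theta_lt.
Qed.

(** Intermediate values on the unit interval: the sum is [#|Theta u|], above 1, at exponent 0 and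
    below 1 at exponent 1. *)
Lemma pressure_blocks_root :
  exists2 s : R, 0 < s & pressure (Theta u) (fun p => V ^+ p) s = 1.
Proof.
pose P := pressure (Theta u) (fun p : 'I_q => V ^+ p).
have P0 : 1 < P 0.
  rewrite /P /pressure (eq_bigr (fun=> 1)) => [|p _]; last by rewrite powRr0.
  by rewrite sumr_const ltr1n card_Theta_gt1.
have cP : continuous P.
  rewrite /P /pressure.
  apply: (@continuous_big _ _ _ _ _ _ _ _ (fun (p : 'I_q) t => (V ^+ p) `^ t)).
    exact: add_continuous.
  move=> p _ t; rewrite /powR gt_eqF ?exprn_gt0//.
  apply: (@continuous_comp _ _ _ (fun t : R => t * ln (V ^+ p)) expR).
    exact: mulrr_continuous.
  exact: continuous_expR.
have P01 : Num.min (P 0) (P 1) <= 1 <= Num.max (P 0) (P 1).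
  by rewrite ge_min le_max (ltW pressure_blocks1) orbT (ltW P0).
have [s + Ps] := IVT ler01 (continuous_subspaceT cP) P01.
rewrite in_itv/= => /andP[s0 s1]; exists s => //.
rewrite lt_neqAle s0 andbT; apply/eqP => s00.
by move: P0; rewrite s00 Ps ltxx.
Qed.

Definition range_dim : R := ln #|Theta u|%:R / ln q%:R.

Lemma range_dim_gt0 : 0 < range_dim.
Proof. by rewrite divr_gt0// ln_gt0// ltr1n ?card_Theta_gt1. Qed.

Lemma pressure_range : pressure (Theta u) (fun=> V) range_dim = 1.
Proof.
have T0 : (0 : R) < #|Theta u|%:R by rewrite ltr0n ltnW ?card_Theta_gt1.
rewrite /pressure sumr_const -[_ *+ #|_|]mulr_natl /powR gt_eqF// lnV ?posrE//.
rewrite mulrN /range_dim divfK ?gt_eqF ?ln_gt0 ?ltr1n//.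
by rewrite expRN lnK ?posrE// divff// gt_eqF.
Qed.

(** At a common positive exponent the ratios q^-p give a strictly smaller sum than q^-1, because
    [Theta] contains a letter above 1. *)
Lemma dims_distinct s : 0 < s ->
  pressure (Theta u) (fun p => V ^+ p) s = 1 -> s <> range_dim.
Proof.
move=> s0 Ps sE; have := pressure_range; rewrite -sE => PE.
have h1 : (1 < q)%N by [].
have [p pT p1] := other_digit card_Theta_gt1 (Ordinal h1).
have p2 : (1 < p)%N.
  by rewrite ltn_neqAle eq_sym (Theta_gt0 pT) andbT -val_eqE in p1 *.
suff : pressure (Theta u) (fun p => V ^+ p) s < pressure (Theta u) (fun=> V) s.
  by rewrite Ps PE ltxx.
rewrite /pressure (bigD1 p)//= [ltRHS](bigD1 p)//=.
apply: ltr_leD.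
  apply: gt0_ltr_powR => //; rewrite ?nnegrE ?exprn_ge0 ?(ltW V0)//.
  by rewrite -[ltRHS]expr1 ltr_iXn2l.
apply: ler_sum => j /andP[jT _]; apply: ge0_ler_powR;
  rewrite ?(ltW s0) ?nnegrE ?exprn_ge0 ?(ltW V0)//.
by rewrite -[leRHS]expr1 Vexp_le// Theta_gt0.
Qed.

End BlockExpansions.

Theorem theorem5 (R : realType) (q : nat) (u : 'I_q) (hq : (3 < q)%N) :
  let D : set R := Dg u in
  let E : set R := Eg u in
  let g : R -> R := g u in
  (* 1 *)
  ([/\ ~ countable D, perfect_set D, nowhere_dense D &
       measurable D /\ lebesgue_measure D = 0%E] /\
   self_similar D /\
   exists alpha0 : R, hausdorff_dim D = alpha0%:E /\
     \sum_(p in Theta u) (q%:R^-1) `^ (p%:R * alpha0) = 1) /\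
  (* 2 *)
  [/\ g @` D = E, self_similar E &
      hausdorff_dim E = (ln #|Theta u|%:R / ln q%:R)%:E] /\
  (* 3 *)
  ((forall x : R, D x -> exists! y : R, g_graph u x y) /\ set_bij D E g) /\
  (* 4 *)
  [/\ (u <= 1)%N -> decreasing_on D g,
      (u = q - 2 :> nat)%N \/ (u = q - 1 :> nat)%N -> increasing_on D g &
      (4 < q)%N -> (2 <= u <= q - 3)%N -> ~ monotonic_on D g] /\
  (* 5 *)
  {within D, continuous g} /\
  (* 6 *)
  (forall x : R, D x -> ~ derivable_on D g x) /\
  (* 7 *)
  (forall a : nat -> 'I_q, Theta_seq u a ->
     (D (Delta (iter (a 0%N) (@sigma q) (blocks u a))) /\
      g (Delta (iter (a 0%N) (@sigma q) (blocks u a))) = Delta (sigma a)) /\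
     (forall n : nat,
        D (Delta (iter (\sum_(i < n) a i)%N (@sigma q) (blocks u a))) /\
        g (Delta (iter (\sum_(i < n) a i)%N (@sigma q) (blocks u a)))
          = Delta (iter n (@sigma q) a))) /\
  (* 8 *)
  (exists S : set R, S `<=` D /\ hausdorff_dim S <> hausdorff_dim (g @` S)).
Proof.
move=> D E gg.
have cX := blocks_coding (R := R) u hq; have cY := Delta_coding (R := R) u hq.
have T2 := card_Theta_gt1 u hq.
have gD a : Theta_seq u a -> gg (Delta (blocks u a)) = Delta a by exact: g_blocks.
have DE : gg @` D = E.
  apply/seteqP; split=> [_ [_ [a ha <-] <-]|_ [a ha <-]].
    by rewrite gD//; exists a.
  by exists (Delta (blocks u a)); [exists a|rewrite gD].
have [s s0 Ps] := pressure_blocks_root (R := R) u hq.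
have dimD := coding_hausdorff_dim cX T2 s0 Ps.
have dimE := coding_hausdorff_dim cY T2 (range_dim_gt0 u hq) (pressure_range u hq).
have P1 := pressure_blocks1 (R := R) u hq.
split; [split; [split|split]|split; [split|split; [split|split; [split|split;
  [|split; [|split]]]]]].
- exact: coding_uncountable cX T2.
- exact: coding_perfect cX T2.
- exact: coding_nowhere_dense cX T2 P1.
- by split; [exact: coding_measurable cX T2|exact: coding_null cX T2 P1].
- exact: coding_self_similar cX T2.
- exists s; split => //; rewrite -[RHS]Ps; apply: eq_bigr => p _.
  by rewrite powRrM powR_mulrn// invr_ge0.
- exact: DE.
- exact: coding_self_similar cY T2.
- exact: dimE.
- move=> _ [a ha <-]; exists (Delta a); split; first by apply/g_graph_blocks.
  by move=> y /(g_graph_blocks hq _ ha) ->.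
- split; [by move=> x Dx; rewrite -DE; exists x| |by rewrite /set_surj DE].
  move=> x y; rewrite !inE => -[a ha <-] [b hb <-]; rewrite !gD//.
  by move=> /(coding_inj cY ha hb) ->.
- exact: g_decreasing.
- by move=> hu; apply: g_increasing => //; lia.
- by move=> _; exact: g_not_monotonic.
- exact: (recoding_continuous cX cY gD).
(* The ratios q^-p and q^-1 agree at the letter 1, and 2 q^-p <= 2 q^-2 <= q^-1 for p >= 2. *)
- have h1 : (1 < q)%N by lia.
  move=> x Dx; apply: (recoding_not_derivable cX cY gD T2 (p0 := Ordinal h1)) => //.
  move=> p pT p1; have p2 : (1 < p)%N.
    by rewrite ltn_neqAle eq_sym (Theta_gt0 pT) andbT -val_eqE in p1 *.
  have q0 : (0 : R) < q%:R by rewrite ltr0n; lia.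
  apply: (@le_trans _ _ (2 * q%:R^-1 ^+ 2)).
    by rewrite ler_pM2l// Vexp_le.
  rewrite expr2 mulrA ler_piMl ?invr_ge0 ?(ltW q0)// ler_pdivrMr// mul1r ler_nat.
  by lia.
- move=> a ha; have hn n : D (Delta (iter (\sum_(i < n) a i) (@sigma q) (blocks u a))) /\
    gg (Delta (iter (\sum_(i < n) a i) (@sigma q) (blocks u a))) =
      Delta (iter n (@sigma q) a).
    rewrite !iter_sigma shiftn_sum_blocks//.
    have hs : Theta_seq u (shiftn n a) by move=> m; exact: ha.
    by rewrite gD//; split => //; exists (shiftn n a).
  by split => //; have := hn 1%N; rewrite big_ord_recl big_ord0 addn0.
(* The whole domain is a witness: its dimension [s] differs from that of its image [E]. *)
- exists D; split => //; rewrite DE => e.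
  have : s%:E = (range_dim u)%:E :> \bar R by rewrite -dimE -dimD.
  by move=> [sE]; exact: dims_distinct sE.
Qed.
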